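(* For any $\beta\geq 0$ and for any starting list $u\in\mathcal{S}$, the following holds. 1. The sequence $(T_m:m\geq 1)$ of jumping times of the process $(U_t^{\beta,u})_{t\in[0,+\infty)}$ satisfies $$\mathbb{P}(\sup\{T_m:m\geq 1\}=+\infty)=1,$$ which assures the existence of the process for all time $t\in[0,+\infty)$. 2. The process $(U_t^{\beta,u})_{t\in[0,+\infty)}$ has a unique invariant probability measure $\mu^{\beta}$.
   Context: Let $N\geq 3$, $\mathcal{A}=\{1,\dots,N\}$ (actors), $\mathcal{O}=\{-1,+1\}$ (opinions), and let $\beta\geq 0$ be the polarization coefficient. The state space is $$\mathcal{S}=\{u=(u(a):a\in\mathcal{A})\in\mathbb{Z}^N:\ \min\{|u(a)|:a\in\mathcal{A}\}=0\}.$$ For $a\in\mathcal{A}$, $\mathfrak{o}\in\mathcal{O}$ and a list $u$, define $\pi^{a,\mathfrak{o}}(u)(b)=u(b)+\mathfrak{o}$ if $b\neq a$, and $\pi^{a,\mathfrak{o}}(u)(a)=0$. The process: starting at time $0$ from $u\in\mathcal{S}$, independent exponential random times with parameters $\exp(\beta\mathfrak{o}u(a))$ are associated to each pair $(a,\mathfrak{o})\in\mathcal{A}\times\mathcal{O}$; when the first of them occurs, with associated pair $(A_1,O_1)$, the list changes from $u$ to $\pi^{A_1,O_1}(u)$; then the procedure is repeated from the new list with new independent exponential times (with parameters computed from the new list), giving $(A_2,O_2)$, and so on. $T_0=0$ and $T_n$ is the time of the $n$-th jump (the cumulative sum of the successive minima). The process is $U_t^{\beta,u}=u$ for $0\leq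 t<T_1$ and $U_t^{\beta,u}=\pi^{A_m,O_m}(U_{T_{m-1}}^{\beta,u})$ for $T_m\leq t<T_{m+1}$; a priori it is defined for $t\in[0,\sup\{T_m:m\geq1\})$. It is a Markov jump process on $\mathcal{S}$ with infinitesimal generator $$\mathcal{G}f(u)=\sum_{\mathfrak{o}\in\mathcal{O}}\sum_{b\in\mathcal{A}}\exp(\beta\mathfrak{o}u(b))\,[f(\pi^{b,\mathfrak{o}}(u))-f(u)]$$ for bounded $f:\mathcal{S}\to\mathbb{R}$. *)

(* Defs.v *)
From HB Require Import structures.
From mathcomp Require Import all_boot all_order all_algebra.
From mathcomp Require Import all_classical all_reals all_analysis.

Set Implicit Arguments.
Unset Strict Implicit.
Unset Printing Implicit Defensive.

Import Order.TTheory GRing.Theory Num.Theory.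

Local Open Scope classical_set_scope.
Local Open Scope ring_scope.

(* [true] stands for the opinion +1 and [false] for -1. *)
Definition opinion := bool.
Definition opinion_val (o : opinion) : int := if o then 1 else -1.

Definition mark N := ('I_N * opinion)%type.

(* [nat] has no neutral element for [minn]; seeding the iterated minimum with
   the maximum of the same family leaves the minimum unchanged. *)
Definition min_abs N (u : {ffun 'I_N -> int}) : nat :=
  (\big[minn/(\max_(a < N) `|u a|)]_(a < N) `|u a|)%N.

Record state N := State {
  state_list :> {ffun 'I_N -> int};
  _ : min_abs state_list == 0%N
}.

HB.instance Definition _ N := [isSub for @state_list N].
HB.instance Definition _ N := [Countable of state N by <:].

Lemma min_abs_eq0 N (u : {ffun 'I_N -> int}) (a : 'I_N) :
  u a = 0 -> min_abs u == 0%N.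
Proof.
move=> ua; rewrite -leqn0 /min_abs -big_filter.
have: a \in [seq i <- index_enum 'I_N | true] by rewrite mem_filter mem_index_enum.
elim: [seq _ <- _ | _] => // b s IHs; rewrite inE big_cons geq_min.
by case/predU1P => [<-|/IHs->]; rewrite ?ua ?orbT.
Qed.

Lemma min_abs_zero N : min_abs [ffun _ : 'I_N => (0 : int)] == 0%N.
Proof.
case: N => [|N]; first by rewrite /min_abs !big_ord0.
by apply: (min_abs_eq0 (a := ord0)); rewrite ffunE.
Qed.

Definition zero_state N : state N := State (min_abs_zero N).

HB.instance Definition _ N := isPointed.Build (state N) (zero_state N).

HB.instance Definition _ N := @isMeasurable.Build default_measure_display
  (state N) discrete_measurable discrete_measurable0
  discrete_measurableC discrete_measurableU.

Definition express_list N (p : mark N) (u : {ffun 'I_N -> int}) :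
    {ffun 'I_N -> int} :=
  [ffun b => if b == p.1 then 0 else u b + opinion_val p.2].

Lemma express_subproof N (p : mark N) (u : state N) :
  min_abs (express_list p u) == 0%N.
Proof. by apply: (min_abs_eq0 (a := p.1)); rewrite ffunE eqxx. Qed.

Definition express N (p : mark N) (u : state N) : state N :=
  State (express_subproof p u).

Definition rate (R : realType) N (beta : R) (u : state N) (p : mark N) : R :=
  expR (beta * (opinion_val p.2)%:~R * (u p.1)%:~R).

(* The pair whose time occurs first. It is [None] only when [N = 0]; ties,
   which have probability zero, are resolved arbitrarily. *)
Definition first_mark (R : realType) N (e : mark N -> R) : option (mark N) :=
  [pick p | [forall q, e p <= e q]].

Section trajectory.
Context (R : realType) (N : nat) (Omega : Type).
(* [tau n p] is the time attached to the pair [p] between the [n]-th and the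
   [n.+1]-th jumps. *)
Variables (u : state N) (tau : nat -> mark N -> Omega -> R).

Fixpoint jump_chain (n : nat) (w : Omega) : state N :=
  if n is m.+1 then
    if first_mark (fun p => tau m p w) is Some p then express p (jump_chain m w)
    else jump_chain m w
  else u.

Definition holding_time (n : nat) (w : Omega) : R :=
  if first_mark (fun p => tau n p w) is Some p then tau n p w else 0.

Definition jump_time (n : nat) (w : Omega) : R :=
  \sum_(k < n) holding_time k w.

(* [None] means that the process is not defined at time [t]. *)
Definition process (t : R) (w : Omega) : option (state N) :=
  match pselect (exists m, jump_time m w <= t < jump_time m.+1 w) with
  | left h => Some (jump_chain (ex_minn h) w)
  | right _ => None
  end.

Definition past (n : nat) : set (set Omega) :=
  <<s [set A | exists k p (Y : set R),
         [/\ (k < n)%N, measurable Y & A = tau k p @^-1` Y]] >>.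

End trajectory.

(* Given the past and given that the current list is [v], the new times are
   independent and exponential with the parameters computed from [v]. *)
Definition exponential_clocks (R : realType) (N : nat) (beta : R)
    d (Omega : measurableType d) (P : probability Omega R) (u : state N)
    (tau : nat -> mark N -> {RV P >-> R}) : Prop :=
  forall (n : nat) (v : state N) (B : set Omega) (Y : mark N -> set R),
    past (fun k p => tau k p : Omega -> R) n B ->
    (forall p, measurable (Y p)) ->
    let C := B `&` [set w | jump_chain u (fun k p => tau k p) n w = v] in
    P (C `&` [set w | forall p, Y p (tau n p w)]) =
      (P C * \prod_p exponential_prob (rate beta v p) (Y p))%E.

(* The process started from [u] is built from the times [tau u]. *)
Definition invariant_probability (R : realType) (N : nat)
    d (Omega : measurableType d) (P : probability Omega R)
    (tau : state N -> nat -> mark N -> {RV P >-> R})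
    (mu : probability (state N) R) : Prop :=
  forall (t : R) (B : set (state N)), 0 <= t ->
    (\int[mu]_u P [set w | exists2 v, B v &
        process u (fun k p => tau u k p) t w = Some v])%E = mu B.

(* Main.v *)
Require Import Defs.
From HB Require Import structures.
From mathcomp Require Import all_boot all_order all_algebra.
From mathcomp Require Import all_classical all_reals all_analysis.
From mathcomp Require Import measurable_realfun zify ring lra.

Set Implicit Arguments.
Unset Strict Implicit.
Unset Printing Implicit Defensive.

Import Order.TTheory GRing.Theory Num.Theory.
Import numFieldNormedType.Exports.

Local Open Scope classical_set_scope.
Local Open Scope ring_scope.
Local Open Scope ereal_scope.

(** In a list [v] the next expression occurs at the total rate [q v], which is
at least 1 because one of the two opinions of any actor has rate at least 1.
The rates are unbounded, so neither part of the theorem follows from general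
bounds; both rest on a Doeblin condition for the embedded jump chain, whose
kernel [embedded] forgets the holding times.

_The Doeblin condition_ ([embedded_doeblin]). From any list, let the actor under
the strongest pressure express the opinion it is pushed to. That mark has the
largest rate, hence probability at least [1/(2N)]. After [N] such steps every
pressure is at most [N] in absolute value: either all actors have spoken in
turn, or somebody spoke twice, and at that moment all pressures were already
small. From a list with such bounded pressures all marks have probabilities
bounded below, and letting the actors speak in order, all with opinion +1, leads
to one fixed list, the [ladder]. So the ladder is reached in [2N] steps with a
probability that is bounded below uniformly in the starting list. On a countable
space this yields a unique invariant probability [p] of the embedded chain, and
shows that every invariant measure with finite mass at the ladder is a multiple
of [p] ([doeblin]).

_No explosion_ ([unbounded_jump_times]). For fixed [t], let [G n v] be the
probability that the [n]-th jump occurs before [t] and leads to [v]. Each step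
multiplies the mass at [v] by at most [1 - exp (- q v t)] before moving it by the
embedded kernel. Among any [2N+1] steps, moving by the embedded kernel brings a fixed
proportion of the mass to the ladder, and there a fixed proportion of it is lost;
so the mass of [G n] decays geometrically.

_The forward equation_ ([occS]). The times attached to the marks are a race of
independent exponential times: the winner is [p] with probability
[rate v p / q v], independently of the winning time, which is exponential with
parameter [q v] ([race]). Hence the probabilities [occ n v t] that the process is
in [v] at time [t] after exactly [n] jumps satisfy a recursion in [n]: enter [v']
at some time [s] from some [v], which happens with density
[jump_rate v v' occ n v s], then stay until [t].

_Invariance is balance_ ([invariant_iff_balanced]). Averaging the recursion over
a starting law [mu] and summing over [n] shows that an invariant [mu] satisfies
the balance equations: the rate of leaving each list equals the rate of entering
it. Conversely, for balanced [mu] the recursion gives, by induction on the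
number of jumps allowed, that the law at time [t] is at most [mu] pointwise; as
there is no explosion both have mass 1, so they are equal.

_Conclusion_ ([balanced_unique]). A measure [nu] is balanced exactly when
[nu v q v] is invariant for the embedded chain, so the only balanced probability
is [p v / q v], normalised; its total mass is finite because [q] is at least 1. *)

(** * Sums over countable types *)

Section CountableSums.
Context (R : realType) (S : countType).
Implicit Types f g : S -> \bar R.

(** Cutting a countable type into the fibres of its coding by integers, each empty
or a singleton, reduces sums over it to series, for which interchange with
integrals is available. *)
Definition code_fiber (k : nat) : set S := [set u | pickle u = k].

Lemma code_fiberP k : code_fiber k = set0 \/ exists u, code_fiber k = [set u].
Proof.
case: (pselect (exists u : S, pickle u = k)) => [[u <-]|nex]; [right|left].
  exists u; apply/seteqP; split => [v|v ->//].
  by rewrite /code_fiber/= => /(pcan_inj pickleK).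
by apply/seteqP; split => // u uk; apply: nex; exists u.
Qed.

Lemma esum_code f : (forall u, 0 <= f u) ->
  \esum_(u in [set: S]) f u = \sum_(k <oo) \esum_(u in code_fiber k) f u.
Proof.
move=> f0; rewrite nneseries_esumT; last by move=> k; exact: esum_ge0.
rewrite -esum_bigcupT//.
- by congr esum; apply/seteqP; split => // u _; exists (pickle u).
- apply/trivIsetP => i j _ _ ij; apply/seteqP; split => // u [ui uj];
    by move: ij; rewrite -ui -uj eqxx.
Qed.

Lemma esum_swap (S' : choiceType) (f : S -> S' -> \bar R) :
  (forall u v, 0 <= f u v) ->
  \esum_(u in [set: S]) \esum_(v in [set: S']) f u v =
  \esum_(v in [set: S']) \esum_(u in [set: S]) f u v.
Proof.
move=> f0; rewrite !esum_esum//.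
rewrite (reindex_esum ([set: S'] `*`` (fun=> [set: S])) _ (fun x => (x.2, x.1)))//.
by split => //= [[u v] [v' u'] _ _ [-> ->]//|[u v] _]; exists (v, u).
Qed.

Lemma esum_pick u f : (forall v, v != u -> f v = 0) -> 0 <= f u ->
  \esum_(v in [set: S]) f v = f u.
Proof.
move=> fu fu0; rewrite -[RHS](@esum_set1 _ _ u)// esum_mkcond [RHS]esum_mkcond.
apply: eq_esum => v _; rewrite in_setT; case: ifPn => //.
by rewrite notin_setE/= => /eqP/fu.
Qed.

Lemma esum_term u f : (forall v, 0 <= f v) -> f u <= \esum_(v in [set: S]) f v.
Proof.
move=> f0; rewrite -[leLHS](@esum_set1 _ _ u)// esum_mkcond.
by apply: le_esum => v _; case: ifP.
Qed.

(** The factor may be infinite: then both sides are zero or infinite together. *)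
Lemma esumZl c f : 0 <= c -> (forall u, 0 <= f u) ->
  \esum_(u in [set: S]) (c * f u) = c * \esum_(u in [set: S]) f u.
Proof.
move=> c0 f0; have [c_fin|] := boolP (c \is a fin_num).
  rewrite !esum_code//; last by move=> u; exact: mule_ge0.
  rewrite -(fineK c_fin) -nneseriesZl; last by move=> k _; exact: esum_ge0.
  apply: eq_eseriesr => k _; rewrite fineK//.
  case: (code_fiberP k) => [->|[u ->]]; first by rewrite !esum_set0 mule0.
  by rewrite !esum_set1// mule_ge0.
rewrite ge0_fin_numE// -leNgt leye_eq => /eqP ->.
have [f_0|] := pselect (forall u, f u = 0).
  by rewrite !esum1 ?mule0// => u _; rewrite f_0 mule0.
move=> /existsNP[u /eqP fu].
have fu_gt0 : 0 < f u by rewrite lt_neqAle eq_sym fu f0.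
rewrite [RHS]gt0_mulye; last by apply: lt_le_trans (esum_term u f0).
apply/eqP; rewrite -leye_eq -[leLHS](gt0_mulye fu_gt0).
by apply: (esum_term u) => v; exact: mule_ge0.
Qed.

Lemma esumZr c f : 0 <= c -> (forall u, 0 <= f u) ->
  \esum_(u in [set: S]) (f u * c) = (\esum_(u in [set: S]) f u) * c.
Proof. by move=> c0 f0; rewrite muleC -esumZl//; apply: eq_esum => u _; rewrite muleC. Qed.

Lemma integral_esum d (T : measurableType d) (mu : {measure set T -> \bar R})
    (D : set T) (f : S -> T -> \bar R) :
  measurable D -> (forall u, measurable_fun D (f u)) ->
  (forall u x, 0 <= f u x) ->
  \int[mu]_(x in D) (\esum_(u in [set: S]) f u x) =
  \esum_(u in [set: S]) \int[mu]_(x in D) f u x.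
Proof.
move=> mD mf f0; rewrite esum_code; last by move=> u; exact: integral_ge0.
under eq_integral do rewrite esum_code//.
rewrite integral_nneseries//; last by move=> k x _; exact: esum_ge0.
  apply: eq_eseriesr => k _; case: (code_fiberP k) => [->|[u ->]].
    by rewrite esum_set0; apply: integral0_eq => x _; rewrite esum_set0.
  rewrite esum_set1 ?integral_ge0//.
  by apply: eq_integral => x _; rewrite esum_set1.
move=> k; case: (code_fiberP k) => [->|[u ->]].
  by under eq_fun do rewrite esum_set0; exact: measurable_cst.
by under eq_fun do rewrite esum_set1//; exact: mf.
Qed.

Lemma measurable_esum d (T : measurableType d) (D : set T)
    (f : S -> T -> \bar R) :
  (forall u, measurable_fun D (f u)) -> (forall u x, 0 <= f u x) ->
  measurable_fun D (fun x => \esum_(u in [set: S]) f u x).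
Proof.
move=> mf f0; under eq_fun do rewrite esum_code//.
apply: ge0_emeasurable_sum => [k x _ _|k _]; first exact: esum_ge0.
case: (code_fiberP k) => [->|[u ->]].
  by under eq_fun do rewrite esum_set0; exact: measurable_cst.
by under eq_fun do rewrite esum_set1//; exact: mf.
Qed.

(** The law of total probability for a variable [Z] with countably many values. *)
Lemma measure_esum d (T : measurableType d) (mu : {measure set T -> \bar R})
    (Z : T -> S) (E : set T) :
  (forall v, measurable (E `&` Z @^-1` [set v])) ->
  mu E = \esum_(v in [set: S]) mu (E `&` Z @^-1` [set v]).
Proof.
move=> mE; rewrite esum_code; last by [].
have -> : E = \bigcup_k (E `&` Z @^-1` code_fiber k).
  apply/seteqP; split => [x Ex|x [k _ []//]].
  by exists (pickle (Z x)).
rewrite measure_bigcup//=; last 2 first.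
- move=> k _; case: (code_fiberP k) => [->|[u ->]]; last exact: mE.
  by rewrite preimage_set0 setI0.
- apply/trivIsetP => i j _ _ ij; apply/seteqP; split => // x [[_ ui] [_ uj]].
  by move: ij; rewrite -ui -uj eqxx.
rewrite [LHS](eq_eseriesl (Q := xpredT)); last by move=> k; rewrite in_setT.
apply: eq_eseriesr => k _.
have EI A : Z @^-1` A `&` E `<=` E by move=> ? [].
have EE v : E `&` Z @^-1` [set v] =
  (\bigcup_k (E `&` Z @^-1` code_fiber k)) `&` Z @^-1` [set v].
  by apply/seteqP; split => [x [Ex zx]|x [[j _ [Ex _]] zx]]; split => //;
    exists (pickle (Z x)).
case: (code_fiberP k) => [->|[u ->]].
  by rewrite preimage_set0 setI0 measure0 esum_set0.
by rewrite esum_set1// EE.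
Qed.

End CountableSums.

Lemma esum_nat_recl (R : realType) (f : nat -> \bar R) : (forall k, 0 <= f k) ->
  \esum_(k in [set: nat]) f k = f 0%N + \esum_(k in [set: nat]) f k.+1.
Proof.
move=> f0; rewrite -!nneseries_esumT// nneseries_recl//; congr (_ + _).
by rewrite -nneseries_addn//; apply: eq_eseriesr => k _; rewrite addn1.
Qed.

Lemma esum_option (R : realType) (I : finType) (f : option I -> \bar R) :
  (forall o, 0 <= f o) -> f None = 0 ->
  \esum_(o in [set: option I]) f o = \sum_(i : I) f (Some i).
Proof.
move=> f0 fN.
rewrite (eq_esum (b := fun o => \sum_(i : I) if o == Some i then f (Some i) else 0)).
  rewrite esum_sum; last by move=> o i _ _; case: ifP.
  apply: eq_bigr => i _; rewrite (esum_pick (u := Some i)) ?eqxx//.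
  by move=> o /negPf ->.
move=> [i|] _; last by rewrite big1.
rewrite (bigD1 i)//= eqxx big1 ?adde0// => j ji.
by case: eqP => // -[ij]; rewrite ij eqxx in ji.
Qed.

(** * Doeblin's theorem on a countable state space *)

Section Kernels.
Context (R : realType) (S : countType).
Implicit Types (rho : S -> \bar R) (K : S -> S -> \bar R).

Definition mass rho := \esum_(u in [set: S]) rho u.

Definition push K rho : S -> \bar R :=
  fun v => \esum_(w in [set: S]) rho w * K w v.

Lemma mass_ge0 rho : (forall u, 0 <= rho u) -> 0 <= mass rho.
Proof. by move=> r0; apply: esum_ge0. Qed.

Lemma push_ge0 K rho : (forall w v, 0 <= K w v) -> (forall u, 0 <= rho u) ->
  forall v, 0 <= push K rho v.
Proof. by move=> K0 r0 v; apply: esum_ge0 => w _; exact: mule_ge0. Qed.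

Lemma mass_push K rho (c : \bar R) : 0 <= c -> (forall w v, 0 <= K w v) ->
  (forall w, mass (K w) = c) -> (forall u, 0 <= rho u) ->
  mass (push K rho) = mass rho * c.
Proof.
move=> c0 K0 Kc r0; rewrite /mass /push esum_swap//; last first.
  by move=> u v; exact: mule_ge0.
rewrite -esumZr//; apply: eq_esum => w _; rewrite esumZl//.
by rewrite -/(mass _) Kc.
Qed.

Lemma le_push K rho1 rho2 : (forall w v, 0 <= K w v) ->
  (forall u, rho1 u <= rho2 u) -> forall v, push K rho1 v <= push K rho2 v.
Proof. by move=> K0 r12 v; apply: le_esum => w _; exact: lee_wpmul2r. Qed.

Lemma push_scale K rho (c : \bar R) : (forall w v, 0 <= K w v) -> 0 <= c ->
  (forall u, 0 <= rho u) ->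
  forall v, push K (fun u => c * rho u) v = c * push K rho v.
Proof.
move=> K0 c0 r0 v; rewrite /push -esumZl//; last by move=> u; exact: mule_ge0.
by apply: eq_esum => w _; rewrite muleA.
Qed.

Lemma push_esum (I : countType) K (rho : I -> S -> \bar R) :
  (forall w v, 0 <= K w v) -> (forall i u, 0 <= rho i u) ->
  forall v, push K (fun u => \esum_(i in [set: I]) rho i u) v =
            \esum_(i in [set: I]) push K (rho i) v.
Proof.
move=> K0 r0 v; rewrite /push esum_swap; last by move=> *; exact: mule_ge0.
by apply: eq_esum => w _; rewrite esumZr.
Qed.

Fixpoint iter_kernel K (m : nat) : S -> S -> \bar R :=
  if m is n.+1 then fun w => push K (iter_kernel K n w)
  else fun w v => (v == w)%:R%:E.

Lemma iter_kernel_ge0 K m : (forall w v, 0 <= K w v) ->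
  forall w v, 0 <= iter_kernel K m w v.
Proof.
move=> K0; elim: m => [|m IH] w v /=; first by rewrite lee_fin.
exact: push_ge0.
Qed.

Lemma mass_iter_kernel K m : (forall w v, 0 <= K w v) ->
  (forall w, mass (K w) = 1) -> forall w, mass (iter_kernel K m w) = 1.
Proof.
move=> K0 K1; elim: m => [|m IH] w /=.
  rewrite /mass (@esum_pick _ _ w)//= ?eqxx// ?lee_fin//.
  by move=> v /negPf ->.
by rewrite (@mass_push _ _ 1)// ?mule1//; exact: iter_kernel_ge0.
Qed.

(** Measures act from the left: iterating the action of a kernel on a measure is
the action of its iterated kernel. *)
Lemma push_iter_kernel K m rho : (forall w v, 0 <= K w v) ->
  (forall u, 0 <= rho u) -> push (iter_kernel K m) rho = iter m (push K) rho.
Proof.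
move=> K0 r0; elim: m => [|m IH]; apply/funext => v /=.
  rewrite /push (@esum_pick _ _ v) ?eqxx ?mule1//.
  by move=> w wv; rewrite eq_sym (negPf wv) mule0.
rewrite -IH {2}/push; under [RHS]eq_esum => w _.
  rewrite {1}/push -esumZr//; last first.
    by move=> u; rewrite mule_ge0 ?iter_kernel_ge0.
  over.
rewrite esum_swap; last first.
  by move=> w u; rewrite !mule_ge0 ?iter_kernel_ge0.
apply: eq_esum => u _; rewrite -esumZl//; last first.
  by move=> w; rewrite mule_ge0 ?iter_kernel_ge0.
by apply: eq_esum => w _; rewrite muleA.
Qed.

Lemma iter_kernel_ge K m (c c' : \bar R) w x y : (forall w v, 0 <= K w v) ->
  0 <= c -> 0 <= c' ->
  c <= iter_kernel K m w x -> c' <= K x y -> c * c' <= iter_kernel K m.+1 w y.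
Proof.
move=> K0 c0 c0' cx cy /=.
apply: (@le_trans _ _ (iter_kernel K m w x * K x y)); first exact: lee_pmul.
apply: (esum_term x (f := fun x => iter_kernel K m w x * K x y)).
by move=> u; rewrite mule_ge0 ?iter_kernel_ge0.
Qed.

(** The workhorse for equalities of measures: one-sided bounds at every point
become equalities as soon as the total masses agree and are finite. *)
Lemma esum_squeeze rho1 rho2 : (forall u, 0 <= rho1 u) ->
  (forall u, rho1 u <= rho2 u) -> mass rho2 <= mass rho1 ->
  mass rho2 < +oo -> forall u, rho1 u = rho2 u.
Proof.
move=> r0 r12 m21 m2 u.
have r20 v : 0 <= rho2 v by exact: le_trans (r12 v).
have fin2 v : rho2 v \is a fin_num.
  by rewrite ge0_fin_numE// (le_lt_trans _ m2)// esum_term.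
have fin1 v : rho1 v \is a fin_num.
  by rewrite ge0_fin_numE// (le_lt_trans (r12 v))// -ge0_fin_numE.
have d0 v : 0 <= rho2 v - rho1 v by rewrite sube_ge0// fin1.
have mE : mass rho2 = mass rho1 + \esum_(v in [set: S]) (rho2 v - rho1 v).
  rewrite /mass -esumD//; apply: eq_esum => v _.
  by rewrite addeC subeK.
have m1fin : mass rho1 \is a fin_num.
  rewrite ge0_fin_numE ?mass_ge0// (le_lt_trans _ m2)//.
  exact: le_esum.
have : \esum_(v in [set: S]) (rho2 v - rho1 v) <= 0.
  by move: m21; rewrite mE -[leRHS]adde0 leeD2lE.
move=> /(le_trans (esum_term u d0)) d_le0.
apply/eqP; rewrite eq_le r12/=.
by rewrite -sube_le0.
Qed.

(** When every row of [Q] gives mass at least [delta] to [l], subtract [delta] at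
[l] from each row. What remains is a kernel with all rows of mass [1 - delta],
whose Neumann series applied to [delta] at [l] converges to an invariant
probability. *)
Section OneStep.
Context (Q : S -> S -> \bar R) (delta : R) (l : S).
Hypotheses (Q0 : forall w v, 0 <= Q w v) (Q1 : forall w, mass (Q w) = 1).
Hypotheses (delta0 : (0 < delta)%R) (Ql : forall w, delta%:E <= Q w l).

Let atom v : \bar R := if v == l then delta%:E else 0.
Let Q' w v : \bar R := Q w v - atom v.

Let atom_ge0 v : 0 <= atom v.
Proof. by rewrite /atom; case: ifP => // _; rewrite lee_fin ltW. Qed.

Let atom_fin v : atom v \is a fin_num.
Proof. by rewrite /atom; case: ifP. Qed.

Let QE w v : Q w v = Q' w v + atom v.
Proof. by rewrite /Q' subeK. Qed.

Let Q'0 w v : 0 <= Q' w v.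
Proof. by rewrite /Q' sube_ge0 ?atom_fin// /atom; case: eqP => [->|]. Qed.

Let mass_atom : mass atom = delta%:E.
Proof.
rewrite /mass (@esum_pick _ _ l) /atom ?eqxx// ?lee_fin ?ltW//.
by move=> v /negPf ->.
Qed.

Let mass_Q' w : mass (Q' w) = (1 - delta)%:E.
Proof.
have : mass (Q w) = mass (Q' w) + mass atom.
  by rewrite /mass -esumD//; apply: eq_esum => v _; exact: QE.
rewrite Q1 mass_atom EFinB => ->; rewrite addeK//.
Qed.

Let delta1 : (0 <= 1 - delta)%R.
Proof. by rewrite -lee_fin -(mass_Q' l); exact: mass_ge0. Qed.

Let push_Q rho : (forall u, 0 <= rho u) ->
  forall v, push Q rho v = push Q' rho v + mass rho * atom v.
Proof.
move=> r0 v; rewrite /push /mass -esumZr// -esumD//.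
- by apply: eq_esum => w _; rewrite QE ge0_muleDr.
- by move=> w _; exact: mule_ge0.
- by move=> w _; exact: mule_ge0.
Qed.

Let c (k : nat) : S -> \bar R := iter k (push Q') atom.

Let c0 k v : 0 <= c k v.
Proof. by elim: k v => [|k IH] v //=; exact: push_ge0. Qed.

Let mass_c k : mass (c k) = (delta * (1 - delta) ^+ k)%:E.
Proof.
elim: k => [|k IH] /=; first by rewrite mass_atom expr0 mulr1.
by rewrite (mass_push (c := (1 - delta)%:E))// IH -EFinM exprSr mulrA.
Qed.

Let pi v : \bar R := \esum_(k in [set: nat]) c k v.

Let pi_ge0 v : 0 <= pi v. Proof. exact: esum_ge0. Qed.

Let pi_recl v : pi v = push Q' pi v + atom v.
Proof.
rewrite [X in _ = X + _](push_esum (rho := c))//.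
by rewrite /pi esum_nat_recl// addeC.
Qed.

Let mass_pi : mass pi = 1.
Proof.
(* needed first: the equation for the mass below also has the solution +oo *)
have le1 : mass pi <= 1.
  rewrite /mass /pi esum_swap//.
  rewrite -nneseries_esumT; last by move=> k; exact: mass_ge0.
  apply: lime_le; first by apply: is_cvg_nneseries => n _ _; exact: mass_ge0.
  apply: nearW => n.
  rewrite (eq_bigr (fun k => (delta * (1 - delta) ^+ k)%:E)); last first.
    by move=> k _; exact: mass_c.
  rewrite sumEFin lee_fin big_mkord.
  have -> : (\sum_(i < n) delta * (1 - delta) ^+ i = 1 - (1 - delta) ^+ n)%R.
    elim: n => [|n IH]; first by rewrite big_ord0 expr0 subrr.
    by rewrite big_ord_recr/= IH exprSr; ring.
  by rewrite gerBl exprn_ge0.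
have : mass pi = mass pi * (1 - delta)%:E + delta%:E.
  rewrite -mass_atom -(mass_push (K := Q') (c := (1 - delta)%:E))//.
  rewrite /mass -esumD//; last by move=> v _; exact: push_ge0.
  by apply: eq_esum => v _; exact: pi_recl.
have : mass pi \is a fin_num.
  by rewrite ge0_fin_numE ?mass_ge0// (le_lt_trans le1)// ltry.
case: (mass pi) => // r _ [] rE; congr (_%:E).
have /eqP : (delta * (r - 1) = 0)%R.
  have -> : (delta * (r - 1) = r - (r * (1 - delta) + delta))%R by ring.
  by rewrite -rE subrr.
by rewrite mulf_eq0 subr_eq0 (gt_eqF delta0) => /eqP.
Qed.

(** Uniqueness: unrolling [rho = rho Q] any finite number of times shows that
[rho] dominates the partial sums of its mass times the Neumann series, and the
masses agree. *)
Lemma doeblin_one_step : exists p : S -> \bar R,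
  [/\ forall v, 0 <= p v, mass p = 1, push Q p = p &
      forall rho, (forall v, 0 <= rho v) -> push Q rho = rho ->
        mass rho < +oo -> forall v, rho v = mass rho * p v].
Proof.
exists pi; split => //.
  by apply/funext => v; rewrite push_Q// mass_pi mul1e -pi_recl.
move=> rho r0 rQ rfin v.
have m0 := mass_ge0 r0.
have mfin : mass rho \is a fin_num by rewrite ge0_fin_numE.
apply/esym; apply: (esum_squeeze (rho1 := fun v => mass rho * pi v)) => //.
- by move=> u; exact: mule_ge0.
- move=> u.
  have ge n x : mass rho * (\sum_(0 <= k < n) c k x) <= rho x.
    elim: n x => [|n IH] x; first by rewrite big_geq// mule0.
    rewrite -[X in _ <= X x]rQ push_Q// big_nat_recl//= ge0_muleDr//; last first.
      by apply: sume_ge0 => k _; exact: (c0 k.+1).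
    rewrite addeC leeD2r//.
    have -> : \sum_(0 <= k < n) push Q' (c k) x =
        push Q' (fun y => \sum_(0 <= k < n) c k y) x.
      rewrite /push -esum_sum; last by move=> *; exact: mule_ge0.
      apply: eq_esum => w _; rewrite ge0_sume_distrl// => k _; exact: c0.
    rewrite -push_scale//; last by move=> y; apply: sume_ge0 => k _; exact: c0.
    exact: le_push.
  rewrite /pi -nneseries_esumT// -(fineK mfin) -nneseriesZl//.
  apply: lime_le; first by apply: is_cvg_nneseries => n _ _; rewrite mule_ge0 ?fineK.
  by apply: nearW => n; rewrite -ge0_sume_distrr ?fineK.
- by rewrite [leRHS]esumZl// -/(mass pi) mass_pi mule1.
Qed.

End OneStep.

(** Invariance for one step and for [m] steps is the same for probabilities: the
one-step image of the [m]-step invariant probability is again [m]-step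
invariant, hence equal to it. For uniqueness it is enough that [rho] be finite
at [l], since the mass of [rho] is at most [rho l / delta]; this allows measures
not known in advance to be finite. *)
Lemma doeblin K (delta : R) (l : S) (m : nat) :
  (forall w v, 0 <= K w v) -> (forall w, mass (K w) = 1) ->
  (0 < delta)%R -> (forall w, delta%:E <= iter_kernel K m w l) ->
  exists p : S -> \bar R,
  [/\ forall v, 0 <= p v, mass p = 1, push K p = p &
      forall rho, (forall v, 0 <= rho v) -> push K rho = rho ->
        rho l < +oo -> mass rho < +oo /\ forall v, rho v = mass rho * p v].
Proof.
move=> K0 K1 d0 Kl.
have [p [p0 p1 pQ uniq]] := doeblin_one_step (iter_kernel_ge0 m K0)
  (mass_iter_kernel m K0 K1) d0 Kl.
exists p; split => //.
  have Kp0 := push_ge0 K0 p0.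
  have Kp1 : mass (push K p) = 1 by rewrite (@mass_push _ _ 1)// mule1.
  apply/funext => v; rewrite (uniq (push K p))//.
  - by rewrite Kp1 mul1e.
  - by rewrite push_iter_kernel// -iterSr iterS -push_iter_kernel// pQ.
  - by rewrite Kp1 ltry.
move=> rho r0 rK rl.
have rQ : push (iter_kernel K m) rho = rho.
  by rewrite push_iter_kernel//; elim: m {uniq pQ Kl} => //= m ->.
have rfin : mass rho < +oo.
  have : mass rho * delta%:E < +oo.
    have le_l : mass rho * delta%:E <= rho l.
      rewrite -[X in _ <= X l]rQ /mass -esumZr//; last by rewrite lee_fin ltW.
      by apply: le_esum => w _; exact: lee_wpmul2l.
    exact: le_lt_trans rl.
  case: (mass rho) (mass_ge0 r0) => [r _ _|_|//]; first by rewrite ltry.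
  by rewrite gt0_mulye// ltxx.
by split=> // v; exact: uniq.
Qed.

End Kernels.

(** * The embedded jump chain *)

Section Rates.
Context (R : realType) (N : nat) (beta : R).
Implicit Types (u v w : state N) (p : mark N).

Definition total_rate u : R := (\sum_p rate beta u p)%R.

Definition jump_rate u v : R := (\sum_(p | express p u == v) rate beta u p)%R.

Lemma rate_gt0 u p : (0 < rate beta u p)%R.
Proof. exact: expR_gt0. Qed.

Lemma total_rate_ge u p : (rate beta u p <= total_rate u)%R.
Proof.
rewrite /total_rate (bigD1 p)//= lerDl sumr_ge0// => q _.
exact/ltW/rate_gt0.
Qed.

Lemma jump_rate_ge0 u v : (0 <= jump_rate u v)%R.
Proof. by apply: sumr_ge0 => p _; exact/ltW/rate_gt0. Qed.

Lemma jump_rate_ge u p : (rate beta u p <= jump_rate u (express p u))%R.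
Proof.
rewrite /jump_rate (bigD1 p)//= lerDl sumr_ge0// => q _.
exact/ltW/rate_gt0.
Qed.

Lemma esum_jump_rate u :
  \esum_(v in [set: state N]) (jump_rate u v)%:E = (total_rate u)%:E.
Proof.
under eq_esum => v _ do rewrite -sumEFin big_mkcond/=.
rewrite esum_sum; last first.
  by move=> v p _ _; case: ifP => // _; rewrite lee_fin ltW// rate_gt0.
rewrite -sumEFin; apply: eq_bigr => p _.
rewrite (@esum_pick _ _ (express p u))/= ?eqxx ?lee_fin ?(ltW (rate_gt0 u p))//.
by move=> v; rewrite eq_sym => /negPf ->.
Qed.

Context (hN : (0 < N)%N).

Let mark0 : mark N := (Ordinal hN, true).

Lemma total_rate_gt0 u : (0 < total_rate u)%R.
Proof. exact: lt_le_trans (rate_gt0 u mark0) (total_rate_ge u mark0). Qed.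

Definition embedded u v : \bar R := (jump_rate u v / total_rate u)%:E.

Lemma embedded_ge0 u v : 0 <= embedded u v.
Proof. by rewrite lee_fin divr_ge0 ?jump_rate_ge0// ltW ?total_rate_gt0. Qed.

Lemma mass_embedded u : mass (embedded u) = 1.
Proof.
rewrite /mass /embedded; under eq_esum => v _ do rewrite EFinM.
rewrite esumZr ?lee_fin ?invr_ge0 ?(ltW (total_rate_gt0 u))//; last first.
  by move=> v; rewrite lee_fin jump_rate_ge0.
by rewrite esum_jump_rate -EFinM divff// gt_eqF// total_rate_gt0.
Qed.

(** A mark whose share of the total rate is at least [c] gives its target
probability at least [c]; other marks may lead to the same list. *)
Lemma embedded_ge u p (c : R) : (c * total_rate u <= rate beta u p)%R ->
  c%:E <= embedded u (express p u).
Proof.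
move=> cu; rewrite lee_fin ler_pdivlMr ?total_rate_gt0//.
exact: le_trans cu (jump_rate_ge u p).
Qed.

Hypothesis beta_ge0 : (0 <= beta)%R.

Lemma rate_exponent_le u p (m : nat) : (`|u p.1| <= m)%N ->
  (`|beta * (opinion_val p.2)%:~R * (u p.1)%:~R| <= beta * m%:R)%R.
Proof.
move=> um; rewrite !normrM ger0_norm// -mulrA ler_wpM2l//.
have -> : (`|(opinion_val p.2)%:~R| = 1 :> R)%R.
  by case: p.2; rewrite /= ?mulrN1z ?normrN ?normr1.
by rewrite mul1r -intr_norm -abszE -pmulrn ler_nat.
Qed.

Definition extreme_mark u : mark N :=
  let a := [arg max_(a > Ordinal hN) `|u a|%N] in (a, (0 <= u a)%R).

Lemma extreme_mark_max u b : (`|u b| <= `|u (extreme_mark u).1|)%N.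
Proof. by rewrite /extreme_mark/=; case: arg_maxnP => //= a _; apply. Qed.

Lemma card_mark : #|{: mark N}| = (N * 2)%N.
Proof. by rewrite card_prod card_ord card_bool. Qed.

(** The largest among [2N] rates is at least their mean. *)
Lemma rate_extreme_mark u :
  (((N * 2)%:R)^-1 * total_rate u <= rate beta u (extreme_mark u))%R.
Proof.
rewrite ler_pdivrMl ?ltr0n ?muln_gt0 ?hN//.
have -> : ((N * 2)%:R * rate beta u (extreme_mark u) =
    \sum_(p : mark N) rate beta u (extreme_mark u))%R.
  by rewrite sumr_const card_mark mulr_natl.
apply: ler_sum => p _; rewrite ler_expR.
apply: (le_trans (ler_norm _)); apply: (le_trans (rate_exponent_le (extreme_mark_max u p.1))).
rewrite -mulrA ler_wpM2l// /extreme_mark/=.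
case: arg_maxnP => //= a _ _.
by rewrite -intrM pmulrn ler_int; case: (ltrP (u a) 0) => ua /=; lia.
Qed.

Lemma expressE u p b :
  express p u b = if b == p.1 then 0%R else (u b + opinion_val p.2)%R.
Proof. by rewrite /= ffunE. Qed.

Lemma express_abs u p b (m : nat) : (`|u b| <= m)%N ->
  (`|express p u b| <= m.+1)%N.
Proof. by rewrite expressE; case: eqP => // _; case: p.2 => /=; lia. Qed.

Definition calm (m : nat) u := forall b, (`|u b| <= m)%N.

Lemma calm_express m u p : calm m u -> calm m.+1 (express p u).
Proof. by move=> um b; exact: express_abs. Qed.

Definition greedy (k : nat) u := iter k (fun v => express (extreme_mark v) v) u.

(** The set [A] collects the actors that have spoken: their pressures are small
since they restart from 0 and change by one unit at a time. If the extreme actor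
has already spoken, its small pressure bounds all the others. *)
Lemma greedy_calm_on k u : calm k (greedy k u) \/
  exists A : {set 'I_N}, #|A| = k /\ forall b, b \in A -> (`|greedy k u b| <= k)%N.
Proof.
elim: k => [|k [IH|[A [Ak IH]]]].
- by right; exists finset.set0; rewrite cards0; split => // b; rewrite finset.in_set0.
- by left; exact: calm_express.
set a := (extreme_mark (greedy k u)).1.
have [aA|aA] := boolP (a \in A).
  left; apply: calm_express => b.
  exact: leq_trans (extreme_mark_max _ b) (IH _ aA).
right; exists (a |: A)%SET; rewrite cardsU1 aA Ak; split => // b.
rewrite finset.in_setU1 => /predU1P[->|bA]; last by apply: express_abs; exact: IH.
by rewrite [greedy _ _]/= expressE eqxx.
Qed.

Lemma greedy_calm u : calm N (greedy N u).
Proof.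
have [//|[A [AN IH]]] := greedy_calm_on N u.
have AT : A = [set: 'I_N]%SET.
  by apply/eqP; rewrite eqEcard finset.subsetT cardsT card_ord AN leqnn.
by move=> b; apply: IH; rewrite AT finset.in_setT.
Qed.

Lemma iter_kernel_greedy k u :
  ((((N * 2)%:R)^-1 ^+ k : R)%:E) <= iter_kernel embedded k u (greedy k u).
Proof.
elim: k => [|k IH]; first by rewrite /= eqxx.
rewrite exprSr EFinM.
apply: (iter_kernel_ge embedded_ge0 _ _ IH).
- by rewrite lee_fin exprn_ge0.
- by rewrite lee_fin.
- by apply: embedded_ge; exact: rate_extreme_mark.
Qed.

Definition ladder_step (k : nat) u :=
  if insub k is Some a then express (a, true) u else u.

Fixpoint climb (k : nat) u : state N :=
  if k is m.+1 then ladder_step m (climb m u) else u.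

Lemma climb_calm k u m : calm m u -> calm (m + k) (climb k u).
Proof.
move=> um; elim: k => [|k IH]; first by rewrite addn0.
rewrite addnS /= /ladder_step; case: insubP => [a _ _|_].
  exact: calm_express.
by move=> b; exact: leqW.
Qed.

(** An actor that spoke at step [b] has since heard [k - b - 1] times opinion +1,
whatever its pressure was before it spoke. *)
Lemma climbE k u (b : 'I_N) : (k <= N)%N -> (b < k)%N ->
  climb k u b = (k - b.+1)%:Z.
Proof.
elim: k => [|k IH] // kN; rewrite ltnS leq_eqVlt /= /ladder_step insubT expressE/=.
have [-> _|bk] := eqVneq b (Ordinal kN); first by rewrite subnn.
rewrite -[_ == k]/(b == Ordinal kN) (negPf bk) /= => ltbk.
rewrite IH ?(ltnW kN)// /opinion_val.
by lia.
Qed.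

Lemma climb_const u v : climb N u = climb N v.
Proof. by apply/val_inj/ffunP => b; rewrite !climbE. Qed.

(** While pressures are at most [2N], each rate lies between [exp (- 2 N beta)] and
[exp (2 N beta)], and [2N] rates make up the total. *)
Let slow : R := ((expR (beta * (N + N)%:R) ^+ 2 * (N * 2)%:R)^-1)%R.

Let slow_gt0 : (0 < slow)%R.
Proof. by rewrite invr_gt0 mulr_gt0 ?exprn_gt0 ?expR_gt0// ltr0n muln_gt0 hN. Qed.

Lemma rate_calm u p : calm (N + N) u -> (slow * total_rate u <= rate beta u p)%R.
Proof.
move=> uc; set e := (beta * (N + N)%:R)%R.
have ub q : (rate beta u q <= expR e)%R.
  by rewrite ler_expR; exact: le_trans (ler_norm _) (rate_exponent_le _).
have lb : (expR (- e) <= rate beta u p)%R.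
  rewrite ler_expR; have := @rate_exponent_le u p _ (uc p.1).
  by rewrite ler_norml => /andP[].
apply: le_trans lb; rewrite ler_pdivrMl ?mulr_gt0 ?exprn_gt0 ?expR_gt0//; last first.
  by rewrite ltr0n muln_gt0 hN.
rewrite expr2 expRN mulrAC mulfK ?gt_eqF ?expR_gt0//.
have -> : (expR e * (N * 2)%:R = \sum_(q : mark N) expR e)%R.
  by rewrite sumr_const card_mark mulr_natr.
exact: ler_sum.
Qed.

Lemma iter_kernel_climb m u v (c : R) k : (k <= N)%N -> (0 <= c)%R ->
  calm N v -> c%:E <= iter_kernel embedded m u v ->
  (c * slow ^+ k)%:E <= iter_kernel embedded (m + k) u (climb k v).
Proof.
move=> + c0 vN cuv; elim: k => [|k IH] kN; first by rewrite mulr1 addn0.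
rewrite exprSr mulrA EFinM addnS.
apply: (iter_kernel_ge embedded_ge0 _ _ (IH (ltnW kN))).
- by rewrite lee_fin mulr_ge0// exprn_ge0// ltW.
- by rewrite lee_fin ltW.
- rewrite /= /ladder_step insubT; apply: embedded_ge; apply: rate_calm => b.
  by apply: (leq_trans (climb_calm k vN b)); rewrite leq_add2l ltnW.
Qed.

Definition ladder : state N := climb N (zero_state N).

(** Calm the list in [N] greedy steps, then climb to the ladder in [N] more. *)
Lemma embedded_doeblin : exists2 delta : R, (0 < delta)%R &
  forall u, delta%:E <= iter_kernel embedded (N + N) u ladder.
Proof.
exists (((N * 2)%:R)^-1 ^+ N * slow ^+ N)%R.
  by rewrite mulr_gt0// exprn_gt0// invr_gt0 ltr0n muln_gt0 hN.
move=> u; rewrite /ladder (climb_const _ (greedy N u)).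
apply: iter_kernel_climb => //; last exact: iter_kernel_greedy.
  exact: greedy_calm.
Qed.

End Rates.

(** * Joint laws, densities and translations *)

Definition image_measure d d' (T1 : measurableType d) (T2 : measurableType d')
    (R : realType) (m : {measure set T1 -> \bar R}) (f : T1 -> T2)
    (mf : measurable_fun setT f) : {measure set T2 -> \bar R} :=
  measure_function_pushforward__canonical__measure_function_Measure m mf.

Section JointLaw.
Context (R : realType) d (Omega : measurableType d).
Variables (m1 m2 : {finite_measure set Omega -> \bar R}).
Variables (nu : probability (measurableTypeR R) R) (c : {nonneg R}).
Variables (X Y : Omega -> measurableTypeR R).
Hypotheses (mX : measurable_fun setT X) (mY : measurable_fun setT Y).

Let mXV A : measurable A -> measurable (X @^-1` A).
Proof. by move=> mA; rewrite -[_ @^-1` _]setTI; exact: mX. Qed.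

Lemma ray_law (m m' : {measure set (measurableTypeR R) -> \bar R}) :
  m setT < +oo -> (forall s : R, m `]s, +oo[%classic = m' `]s, +oo[%classic) ->
  forall A, measurable A -> m A = m' A.
Proof.
move=> mfin mm'; apply: (@measure_unique _ R (measurableTypeR R) (@RGenOInfty.G R) (fun n => `](- n%:R)%R, +oo[%classic)).
- exact: RGenOInfty.measurableE.
- move=> _ _ [x ->] [y ->]; exists (Num.max x y).
  apply/seteqP; split => z /=; rewrite !in_itv/= !andbT gt_max.
    by move=> [-> ->].
  by move=> /andP.
- by move=> n; exists (- n%:R)%R.
- apply/seteqP; split => // x _; exists (Num.truncn `|x|).+1 => //=.
  rewrite in_itv/= andbT ltrNl.
  by apply: le_lt_trans (truncnS_gt `|x|); rewrite -normrN ler_norm.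
- by move=> _ [s ->]; exact: mm'.
- by move=> n; apply: le_lt_trans mfin; apply: le_measure; rewrite ?inE.
Qed.

(** Independence read off on rays: if [Y] exceeds [s], jointly with any event of
[X], with the probabilities of an independent [nu]-distributed variable, then
the pair [(X, Y)] has a product law. The two measures [m1] and [m2] allow [Y] to
be restricted by a further event of conditional probability [c], here the
identity of the winner of a race. *)
Lemma joint_law :
  (forall A (s : R), measurable A -> m1 (X @^-1` A `&` Y @^-1` `]s, +oo[%classic) =
     c%:num%:E * (m2 (X @^-1` A) * nu `]s, +oo[%classic)) ->
  forall E, measurable E -> m1 ((fun w => (X w, Y w)) @^-1` E) =
     c%:num%:E * \int[m2]_w nu (xsection E (X w)).
Proof.
move=> H.
have mXY : measurable_fun setT (fun w => (X w, Y w)) by exact: measurable_fun_pair.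
have mXid : measurable_fun setT (fun z : Omega * measurableTypeR R => (X z.1, z.2)).
  by apply: measurable_fun_pair => //; exact: measurableT_comp.
pose M1 := image_measure m1 mXY.
pose M2 := mscale c (image_measure (m2 \x nu) mXid).
move=> E mE; have -> : c%:num%:E * \int[m2]_w nu (xsection E (X w)) = M2 E.
  by rewrite /M2 /mscale/= /pushforward /product_measure1.
rewrite -[LHS]/(M1 E).
have step A B : measurable A -> measurable B ->
    m1 (X @^-1` A `&` Y @^-1` B) = c%:num%:E * (m2 (X @^-1` A) * nu B).
  move=> mA mB; pose m1A := mrestr m1 (mXV mA).
  have fA : m2 (X @^-1` A) \is a fin_num by rewrite fin_num_measure//; exact: mXV.
  have cA : (0 <= c%:num * fine (m2 (X @^-1` A)))%R by rewrite mulr_ge0// fine_ge0.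
  pose mn := mscale (NngNum cA) nu.
  have mnE D : mn D = c%:num%:E * (m2 (X @^-1` A) * nu D).
    by rewrite muleA -(fineK fA) -EFinM.
  rewrite setIC -[LHS]/(image_measure m1A mY B) (@ray_law _ mn) ?mnE//.
  - rewrite /= /pushforward /m1A /mrestr -ge0_fin_numE// fin_num_measure//.
    by apply: measurableI; [rewrite preimage_setT|exact: mXV].
  - move=> s; rewrite /= /pushforward /m1A /mrestr setIC H// -mnE.
apply: (measure_unique [set A `*` B | A in measurable & B in measurable] (fun=> setT)) mE.
- exact: measurable_prod_measurableType.
- move=> _ _ [A mA [B mB <-]] [A' mA' [B' mB' <-]]; rewrite -setXI.
  by exists (A `&` A'); [exact: measurableI|exists (B `&` B') => //; exact: measurableI].
- by move=> _; exists setT => //; exists setT => //; rewrite setXTT.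
- by apply/seteqP; split => // x _; exists 0%N.
- move=> _ [A mA [B mB <-]].
  transitivity (c%:num%:E * (m2 (X @^-1` A) * nu B)); first exact: step.
  rewrite /M2 /mscale/= /pushforward; congr (_ * _).
  by rewrite -product_measure1E//; exact: mXV.
- move=> _; rewrite /M1/= /pushforward preimage_setT -ge0_fin_numE//.
  by rewrite fin_num_measure.
Qed.
End JointLaw.

(** The usual formula for integration against a measure with a finite density,
from indicators to simple functions to monotone limits. *)
Section Density.
Context (R : realType) d (T : measurableType d).
Variables (mu nu : {measure set T -> \bar R}) (f : T -> \bar R).
Hypotheses (mf : measurable_fun setT f) (f0 : forall x, 0 <= f x).
Hypothesis nuE : forall A, measurable A -> nu A = \int[mu]_(x in A) f x.

Hypothesis ffin : forall x, f x \is a fin_num.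

Import HBNNSimple.

Let density_nnsfun (h : {nnsfun T >-> R}) :
  \int[nu]_x (h x)%:E = \int[mu]_x ((h x)%:E * f x).
Proof.
have mind r : measurable_fun setT (fun x => (r * \1_(h @^-1` [set r]) x)%:E).
  by apply: (measurable_comp measurableT) => //; exact: measurable_funM.
transitivity (\int[nu]_x
    (\sum_(y \in range h) (y * \1_(h @^-1` [set y]) x)%:E)).
  by apply: eq_integral => x _; rewrite fimfunE -fsumEFin.
rewrite ge0_integral_fsum//; last by move=> y x _; exact: nnfun_muleindic_ge0.
transitivity (\int[mu]_x (\sum_(y \in range h)
    (y * \1_(h @^-1` [set y]) x)%:E * f x)); last first.
  apply: eq_integral => x _.
  rewrite -ge0_mule_fsuml => [|y]; last exact: nnfun_muleindic_ge0.
  by rewrite fsumEFin // -(fimfunE _ x).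
rewrite ge0_integral_fsum//; last 2 first.
- by move=> y; exact: emeasurable_funM.
- by move=> y x _; rewrite mule_ge0// nnfun_muleindic_ge0.
apply: eq_fsbigr => y /set_mem [z _ zy].
have y0 : (0 <= y)%R by rewrite -zy.
under eq_integral do rewrite EFinM.
rewrite integralZl_indic_nnsfun// integral_indic// setIT nuE//.
under [RHS]eq_integral do rewrite EFinM -muleA.
rewrite ge0_integralZl//.
- congr (_ * _); rewrite integral_mkcond; apply: eq_integral => x _.
  by rewrite patchE indicE; case: (x \in _); rewrite ?mul1e ?mul0e.
- by apply: emeasurable_funM => //; apply: (measurable_comp measurableT).
- by move=> x _; rewrite mule_ge0// lee_fin.
Qed.

Lemma integral_density g : measurable_fun setT g -> (forall x, 0 <= g x) ->
  \int[nu]_x g x = \int[mu]_x (g x * f x).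
Proof.
move=> mg g0; pose h := nnsfun_approx measurableT mg.
have mh n : measurable_fun setT (EFin \o h n) by exact/measurable_EFinP.
have ndh x : {homo (fun n => (h n x)%:E) : m n / (m <= n)%N >-> m <= n}.
  by move=> m n mn; rewrite lee_fin; exact/lefP/nd_nnsfun_approx.
transitivity (limn (fun n => \int[nu]_x (EFin \o h n) x)).
  rewrite -monotone_convergence//; last 2 first.
  - by move=> n x _; rewrite lee_fin.
  - by move=> x _; exact: ndh.
  apply: eq_integral => x _; apply/esym/cvg_lim => //.
  exact: cvg_nnsfun_approx.
transitivity (limn (fun n => \int[mu]_x ((EFin \o h n) \* f) x)).
  by apply: congr_lim; apply/funext => n; rewrite density_nnsfun.
rewrite -monotone_convergence//; last 3 first.
- by move=> n; exact: emeasurable_funM.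
- by move=> n x _; rewrite mule_ge0// lee_fin.
- by move=> x _ m n mn; rewrite lee_wpmul2r//; exact: ndh.
apply: eq_integral => x _; apply/cvg_lim => //.
apply: cvgeZr; first exact: ffin.
exact: cvg_nnsfun_approx.
Qed.

End Density.

Section Translation.
Context (R : realType).
Local Notation leb := (@lebesgue_measure R).

Lemma measurable_shift (x : R) : measurable_fun setT (fun y : R => (x + y)%R).
Proof. exact: measurable_funD. Qed.

Lemma integral_shift (x : R) (A : set R) (f : R -> \bar R) :
  measurable A -> measurable_fun setT f -> (forall y, 0 <= f y) ->
  \int[leb]_(y in (fun y => x + y)%R @^-1` A) f y =
  \int[leb]_(s in A) f (s - x)%R.
Proof.
move=> mA mf f0.
pose phi : measurableTypeR R -> measurableTypeR R := fun y => (x + y)%R.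
have mphi : measurable_fun setT phi := measurable_shift x.
pose m := image_measure leb mphi.
have mE B : measurable B -> m B = leb B.
  move=> mB; apply/esym; apply: lebesgue_measure_unique mB => _ [[a b]] _ <-.
  rewrite /m/= /pushforward.
  have -> : phi @^-1` `]a, b] = `]a - x, b - x]%classic%R.
    apply/seteqP; split => y /=; rewrite !in_itv/= /phi; lra.
  rewrite !lebesgue_measure_itv/= !lte_fin ltrD2r.
  by case: ifP => // _; rewrite -!EFinB; congr (_%:E); ring.
have mg : measurable_fun setT (fun s : R => f (s - x)%R).
  by apply: measurableT_comp mf _; exact: measurable_funB.
transitivity (\int[m]_(s in A) f (s - x)%R); last first.
  by apply: eq_measure_integral => B mB _; exact: mE.
rewrite [RHS](ge0_integral_pushforward mphi)//; last first.
  exact/measurable_funTS.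
by apply: eq_integral => y _ /=; rewrite /phi addrAC subrr add0r.
Qed.

End Translation.

Lemma integral_mrestr d (T : measurableType d) (R : realType)
    (mu : {measure set T -> \bar R}) (D : set T) (mD : measurable D)
    (g : T -> \bar R) :
  measurable_fun setT g -> (forall x, 0 <= g x) ->
  \int[mrestr mu mD]_x g x = \int[mu]_x (g x * (\1_D x)%:E).
Proof.
move=> mg g0; apply: integral_density => //.
- by apply/measurable_EFinP; exact: measurable_indic.
- by move=> A mA; rewrite integral_indic// setIC.
Qed.

(** * Exponential laws *)

Section Exponential.
Context (R : realType).
Implicit Types r s : R.

Definition exponential_law r (r0 : (0 < r)%R) : probability _ R :=
  exponential_distribution_exponential_prob__canonical__probability_measure_Probability r0.

Lemma derive1_tail r x : (fun z : R => (- expR (- r * z))%R)^`()%classic x = (r * expR (- r * x))%R.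
Proof.
rewrite derive1_comp// derive1N// derive1_id mulN1r derive1_comp// derive1E.
have /funeqP -> := @derive_expR R.
by rewrite derive1Ml// derive1_id mulr1 mulrN opprK mulrC.
Qed.

Lemma exponential_tail r s : (0 < r)%R -> (0 <= s)%R ->
  exponential_prob r `]s, +oo[ = (expR (- r * s))%:E.
Proof.
move=> r0 s0; rewrite /exponential_prob integral_itv_obnd_cbnd; last first.
  by apply/measurable_funTS/measurable_EFinP; exact: measurable_exponential_pdf.
have cexp : continuous (fun z : R => expR (- r * z)%R).
  move=> z; apply: continuous_comp; last exact: continuous_expR.
  by apply: continuousM => //; apply: (@continuousN _ R^o); exact: cst_continuous.
rewrite (@ge0_continuous_FTC2y _ _ (fun x => - (expR (- r * x)))%R _ 0%R)//.
- by rewrite EFinN oppeK add0e.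
- by move=> x _; apply: exponential_pdf_ge0; exact: ltW.
- apply: (@continuous_subspaceW R^o _ _ [set` `[0%R, +oo[%R]).
    by apply: subset_itvr; rewrite bnd_simp.
  exact: within_continuous_exponential_pdf.
- rewrite -oppr0; apply: cvgN.
  rewrite (_ : (fun x => expR (- r * x)) =
               (fun z => expR (- z)) \o (fun z => r * z))%R; last first.
    by apply: eq_fun => x; rewrite mulNr.
  apply: (@cvg_comp _ _ _ _ _ _ (pinfty_nbhs R)); last exact: cvgr_expR.
  exact: gt0_cvgMry.
- by apply: cvgN; apply/cvg_at_right_filter; exact: cexp.
- move=> x; rewrite in_itv/= andbT => sx.
  by rewrite derive1_tail exponential_pdfE// (le_trans s0)// ltW.
Qed.

(** The tail function on the whole real line: below 0 the exponential time exceeds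
[s] surely. *)
Definition tail r s : R := expR (- r * Num.max s 0)%R.

Lemma exponential_ray r s : (0 < r)%R ->
  exponential_prob r `]s, +oo[ = (tail r s)%:E.
Proof.
move=> r0; rewrite /tail; have [s0|s0] := leP 0%R s.
  by rewrite exponential_tail.
apply/eqP; rewrite mulr0 expR0 eq_le; apply/andP; split.
  exact: (probability_le1 (exponential_law r0)).
have := exponential_tail r0 (lexx 0%R).
rewrite mulr0 expR0 => <-.
apply: (le_measure (exponential_law r0)); rewrite ?inE//.
by apply: subset_itvr; rewrite bnd_simp ltW.
Qed.

Lemma exponential_itv r (a b : R) : (0 < r)%R -> (0 <= a)%R -> (a <= b)%R ->
  exponential_prob r `]a, b] = (expR (- r * a) - expR (- r * b))%:E.
Proof.
move=> r0 a0 ab; have b0 := le_trans a0 ab.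
have <- : `]a, +oo[ `\` `]b, +oo[ = `]a, b]%classic :> set R.
  apply/seteqP; split => x /=; rewrite !in_itv/= ?andbT.
    by move=> [-> /negP]; rewrite -leNgt.
  by move=> /andP[-> xb]; split => //; apply/negP; rewrite -leNgt.
rewrite EFinB -!exponential_tail//.
rewrite (measureD (mu := exponential_law r0))//=; last first.
  by rewrite exponential_tail// ltry.
congr (_ - exponential_prob r _); apply: setIidr.
by apply: subset_itvr; rewrite bnd_simp.
Qed.

End Exponential.

(** * The winning mark and the measurability of the trajectory *)

Section FirstMark.
Context (R : realType) (N : nat).
Implicit Type e : mark N -> R.

Lemma first_markP e p : first_mark e = Some p -> forall p', (e p <= e p')%R.
Proof.
rewrite /first_mark; case: pickP => // p1 /forallP le [<-] p'; exact: le.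
Qed.

Lemma first_mark_uniq e p : (forall p', p' != p -> (e p < e p')%R) ->
  first_mark e = Some p.
Proof.
move=> lt; rewrite /first_mark; case: pickP => [p1 /forallP le|/(_ p)/forallP[p']].
  by have [-> //|/lt] := eqVneq p1 p; rewrite ltNge le.
by have [-> //|/lt/ltW] := eqVneq p' p.
Qed.

End FirstMark.

(** The sigma-algebra is left arbitrary so that these lemmas apply both to the
underlying probability space and to the sigma-algebra of the past. *)
Section Measurability.
Context (R : realType) (N : nat) d (T : measurableType d).
Variables (tau : nat -> mark N -> T -> R) (u : state N).

(** The winner depends only on the finitely many comparisons between times. *)
Lemma measurable_first_mark (e : mark N -> T -> R) (o : option (mark N)) :
  (forall p, measurable_fun setT (e p)) ->
  measurable [set w | first_mark (e ^~ w) = o].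
Proof.
move=> me.
pose B w := [ffun pq : mark N * mark N => (e pq.1 w <= e pq.2 w)%R].
pose G (f : {ffun mark N * mark N -> bool}) : option (mark N) :=
  [pick p | [forall q, f (p, q)]].
have GE w : first_mark (e ^~ w) = G (B w).
  by apply: eq_pick => p /=; apply: eq_forallb => q; rewrite ffunE.
have -> : [set w | first_mark (e ^~ w) = o] =
    \bigcup_(f in [set f | G f = o]) \bigcap_(pq in [set: mark N * mark N])
      [set w | (e pq.1 w <= e pq.2 w)%R = f pq].
  apply/seteqP; split => [w /=|w [f /= Gf fw]].
    by rewrite GE => BGo; exists (B w) => // pq _ /=; rewrite ffunE.
  rewrite GE; suff -> : B w = f by [].
  by apply/ffunP => pq; rewrite ffunE; exact: fw.
apply: fin_bigcup_measurable; first exact: finite_finset.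
move=> f _; apply: fin_bigcap_measurable; first exact: finite_finset.
move=> pq _.
have := @measurable_fun_ler _ T R setT _ _ (me pq.1) (me pq.2) measurableT [set f pq].
by rewrite setTI; exact.
Qed.

Variable n : nat.
Hypothesis mtau : forall k p, (k < n)%N -> measurable_fun setT (tau k p).

Lemma measurable_mark k o : (k < n)%N ->
  measurable [set w | first_mark (fun p => tau k p w) = o].
Proof. by move=> kn; apply: measurable_first_mark => p; exact: mtau. Qed.

Lemma measurable_holding k : (k < n)%N -> measurable_fun setT (holding_time tau k).
Proof.
move=> kn.
have -> : holding_time tau k = fun w =>
    (\sum_(p : mark N) \1_[set w | first_mark (fun p => tau k p w) = Some p] w * tau k p w)%R.
  apply/funext => w; rewrite /holding_time.
  case E : (first_mark _) => [p|].
    rewrite (bigD1 p)//= big1 => [|q qp]; rewrite indicE.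
      by rewrite mem_set//= mul1r addr0.
    by rewrite memNset ?mul0r//= E => -[pq]; rewrite pq eqxx in qp.
  rewrite big1// => q _; rewrite indicE memNset ?mul0r//=.
  by rewrite E.
apply: measurable_sum => p; apply: measurable_funM; last exact: mtau.
by apply: measurable_indic; exact: measurable_mark.
Qed.

Lemma measurable_jump_time m : (m <= n)%N -> measurable_fun setT (jump_time tau m).
Proof.
elim: m => [|m IH] mn.
  rewrite (_ : jump_time tau 0 = cst 0%R)//.
  by apply/funext => w; rewrite /jump_time big_ord0.
rewrite (_ : jump_time tau m.+1 = jump_time tau m \+ holding_time tau m)%R.
  by apply: measurable_funD; [exact/IH/ltnW|exact: measurable_holding].
by apply/funext => w; rewrite /jump_time big_ord_recr.
Qed.

Lemma measurable_jump_chain m (V : set (state N)) : (m <= n)%N ->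
  measurable (jump_chain u tau m @^-1` V).
Proof.
elim: m V => [|m IH] V mn.
  have [uV|uV] := pselect (V u); [rewrite (_ : _ @^-1` _ = setT)//|
    rewrite (_ : _ @^-1` _ = set0)//]; by apply/seteqP; split.
have -> : jump_chain u tau m.+1 @^-1` V = \bigcup_(o in [set: option (mark N)])
    ([set w | first_mark (fun p => tau m p w) = o] `&`
     jump_chain u tau m @^-1` [set v | V (if o is Some p then express p v else v)]).
  apply/seteqP; split => [w Vw|w [m0 _ [mo]]].
    by exists (first_mark (fun p => tau m p w)) => //; split => //; move: Vw => /=; case: first_mark.
  by rewrite /preimage/= mo; case: m0 {mo}.
apply: fin_bigcup_measurable; first exact: finite_finset.
by move=> o _; apply: measurableI; [exact: measurable_mark|exact/IH/ltnW].
Qed.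

End Measurability.

(** * Races between exponential times *)

Section RealFacts.
Context (R : realType).
Implicit Types x y : R.

Lemma le_of_arch_bounds x y : (0 <= y)%R ->
  (forall j : nat, y * (1 - 2 / j.+1%:R) <= x)%R -> (y <= x)%R.
Proof.
move=> y0 H; rewrite leNgt; apply/negP => xy.
have d0 : (0 < y - x)%R by rewrite subr_gt0.
pose j := Num.truncn (2 * y / (y - x)).
have jb : (2 * y / (y - x) < j.+1%:R)%R by exact: truncnS_gt.
have := H j; rewrite leNgt => /negP; apply.
have j0 : (0 < j.+1%:R :> R)%R by rewrite ltr0n.
move: jb; rewrite ltr_pdivrMr// => jb.
have -> : (y * (1 - 2 / j.+1%:R) = y - 2 * y / j.+1%:R)%R by ring.
rewrite ltrBrDr -ltrBrDl ltr_pdivrMr//.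
by rewrite [ltRHS]mulrC.
Qed.

(** The probability that a time of parameter [r] falls in the [k]-th cell of mesh
[h] after [s], while a competing time of parameter [q - r] exceeds the end of
that cell. *)
Definition win_cell (q r s h : R) (k : nat) : R :=
  ((expR (- r * (s + k%:R * h)) - expR (- r * (s + k.+1%:R * h))) *
   expR (- (q - r) * (s + k.+1%:R * h)))%R.

(** Both sides are [exp (- q (s + (k+1) h))] times a factor, and
[exp (r h) - 1 >= r h >= (r / q) (1 - exp (- q h))]. The lower bound telescopes
in [k]. *)
Lemma win_cell_ge q r s h k : (0 < q)%R -> (0 < r)%R ->
  (r / q * expR (- q * s) * (expR (- q * h) * (expR (- q * h) ^+ k - expR (- q * h) ^+ k.+1))
   <= win_cell q r s h k)%R.
Proof.
move=> q0 r0; set t := (s + k.+1%:R * h)%R.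
have -> : win_cell q r s h k = (expR (- q * t) * (expR (r * h) - 1))%R.
  rewrite /win_cell -/t mulrBl -!expRD mulrBr mulr1 -expRD.
  congr (expR _ - expR _)%R; last by ring.
  by rewrite /t -natr1; ring.
have -> : (r / q * expR (- q * s) * (expR (- q * h) *
    (expR (- q * h) ^+ k - expR (- q * h) ^+ k.+1)) =
    expR (- q * t) * (r / q * (1 - expR (- q * h))))%R.
  have -> : expR (- q * t) = (expR (- q * s) * (expR (- q * h) * expR (- q * h) ^+ k))%R.
    rewrite -exprS -expRM_natl -expRD /t; congr expR; ring.
  rewrite exprS; ring.
rewrite ler_wpM2l ?expR_ge0//.
apply: (@le_trans _ _ (r * h)%R).
  rewrite -mulrA ler_wpM2l ?(ltW r0)// ler_pdivrMl//.
  have := expR_ge1Dx (- q * h)%R; lra.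
by have := expR_ge1Dx (r * h)%R; lra.
Qed.

(** Mesh [1 / ((j+1) q)] and [(j+1)^2] cells: the mesh tends to 0 while the covered
length tends to infinity. *)
Lemma sum_win_cells q r s (j : nat) : (0 < q)%R -> (0 < r)%R ->
  exists2 h : R, (0 < h)%R & exists K : nat,
  (r / q * expR (- q * s) * (1 - 2 / j.+1%:R) <= \sum_(k < K) win_cell q r s h k)%R.
Proof.
move=> q0 r0; set a := (j.+1%:R^-1 : R)%R.
have a0 : (0 < a)%R by rewrite invr_gt0 ltr0n.
exists (a / q)%R; first exact: divr_gt0.
exists (j.+1 * j.+1)%N.
apply: (@le_trans _ _ (\sum_(k < j.+1 * j.+1) r / q * expR (- q * s) *
   (expR (- a) * (expR (- a) ^+ k - expR (- a) ^+ k.+1)))%R); last first.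
  apply: ler_sum => k _.
  have -> : (- a = - q * (a / q))%R by field; rewrite gt_eqF.
  exact: win_cell_ge.
rewrite -!mulr_sumr ler_wpM2l//.
  by rewrite mulr_ge0 ?expR_ge0// divr_ge0// ltW.
have -> : (\sum_(k < j.+1 * j.+1) (expR (- a) ^+ k - expR (- a) ^+ k.+1) =
    1 - expR (- a) ^+ (j.+1 * j.+1))%R.
  elim: (_ * _)%N => [|n IH]; first by rewrite big_ord0 expr0 subrr.
  by rewrite big_ord_recr/= IH; ring.
have ea : (1 - a <= expR (- a))%R := expR_ge1Dx (- a)%R.
have -> : (expR (- a) ^+ (j.+1 * j.+1) = (expR j.+1%:R)^-1)%R.
  rewrite -expRM_natl -expRN natrM; congr expR.
  by rewrite /a mulrN mulfK ?pnatr_eq0.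
have eb : ((expR j.+1%:R)^-1 <= a)%R.
  rewrite /a lef_pV2 ?posrE ?expR_gt0 ?ltr0n//.
  by have := expR_ge1Dx (j.+1%:R : R)%R; lra.
have a1 : (a <= 1)%R by rewrite /a invf_le1 ?ler1n ?ltr0n.
apply: (@le_trans _ _ ((1 - a) * (1 - a))%R); first by nra.
by apply: ler_pM => //; lra.
Qed.

End RealFacts.

(** The process started from one list [u]; [Z], [T] and [H] are the jump chain,
the jump times and the holding times. *)
Section Process.
Context (R : realType) (N : nat) (beta : R).
Context d (Omega : measurableType d) (P : probability Omega R) (u : state N).
Variable tau : nat -> mark N -> {RV P >-> R}.
Hypothesis hN : (0 < N)%N.
Hypothesis clocks : exponential_clocks beta u tau.

Local Notation X := (fun k p => tau k p : Omega -> R).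
Local Notation Z := (jump_chain u X).
Local Notation H := (holding_time X).
Local Notation T := (jump_time X).
Local Notation r := (rate beta).
Local Notation q := (total_rate beta).
Local Notation leb := (@lebesgue_measure R).

Definition mark_at n (w : Omega) : option (mark N) :=
  first_mark (fun p => tau n p w).

Let mX k p : measurable_fun setT (X k p). Proof. exact: measurable_funPT. Qed.

Lemma measurable_mark_at n o : measurable (mark_at n @^-1` [set o]).
Proof. by apply: (@measurable_mark _ _ _ _ X n.+1) => // k p _; exact: mX. Qed.

Lemma measurable_H n : measurable_fun setT (H n).
Proof. by apply: (@measurable_holding _ _ _ _ X n.+1) => // k p _; exact: mX. Qed.

Lemma measurable_T n : measurable_fun setT (T n).
Proof. by apply: (@measurable_jump_time _ _ _ _ X n) => // k p _; exact: mX. Qed.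

Lemma measurable_Z n V : measurable (Z n @^-1` V).
Proof. by apply: (@measurable_jump_chain _ _ _ _ X u n) => // k p _; exact: mX. Qed.

Lemma past_measurable n B : past X n B -> measurable B.
Proof.
apply: smallest_sub; first exact: sigma_algebra_measurable.
move=> _ [k [p [Y [_ mY ->]]]].
by rewrite -[_ @^-1` _]setTI; exact: mX.
Qed.

Lemma past_jump_time n A : measurable A -> past X n (T n @^-1` A).
Proof.
pose G := [set A | exists k p (Y : set R),
         [/\ (k < n)%N, measurable Y & A = X k p @^-1` Y]].
have mG k p : (k < n)%N -> measurable_fun (setT : set (g_sigma_algebraType G)) (X k p).
  (* each earlier clock generates part of the past *)
  move=> kn _ Y mY; rewrite setTI; apply: sub_sigma_algebra.
  by exists k, p, Y.
move=> mA.
have := @measurable_jump_time R N _ (g_sigma_algebraType G) X n mG n (leqnn n) measurableT A mA.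
by rewrite setTI.
Qed.

Section Event.
Variables (n : nat) (v : state N) (B : set Omega).
Hypothesis pB : past X n B.

Let C := B `&` Z n @^-1` [set v].
Let W p s := C `&` mark_at n @^-1` [set Some p] `&` H n @^-1` `]s, +oo[.

Let mC : measurable C.
Proof. by apply: measurableI; [exact: past_measurable pB|exact: measurable_Z]. Qed.

Let mtau p Y : measurable Y -> measurable (tau n p @^-1` Y).
Proof. by move=> mY; rewrite -[_ @^-1` _]setTI; exact: measurable_funPT. Qed.

Let mW p s : measurable (W p s).
Proof.
apply: measurableI; first by apply: measurableI => //; exact: measurable_mark_at.
by rewrite -[_ @^-1` _]setTI; exact: measurable_H.
Qed.

Let WE p s : W p s = C `&` [set w | forall p', (s < tau n p' w)%R] `&`
  mark_at n @^-1` [set Some p].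
Proof.
rewrite /W; apply/seteqP; split => w /=.
  move=> [[Cw mw]]; rewrite in_itv/= andbT /holding_time -/(mark_at n w) mw => sw.
  by do 2 split => //; move=> p'; exact: lt_le_trans sw (first_markP mw _).
by move=> [[Cw sw mw]]; rewrite in_itv/= andbT /holding_time -/(mark_at n w) mw.
Qed.

Let box (Y : mark N -> set R) : (forall p, measurable (Y p)) ->
  P (C `&` [set w | forall p, Y p (tau n p w)]) =
  P C * \prod_p exponential_prob (r v p) (Y p).
Proof. exact: (clocks v pB). Qed.

Let window p s h k (p' : mark N) : set R :=
  if p' == p then `]s + k%:R * h, s + k.+1%:R * h]%classic%R
             else `]s + k.+1%:R * h, +oo[%classic%R.

Let measurable_window p s h k p' : measurable (window p s h k p').
Proof. by rewrite /window; case: ifP. Qed.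

(** On a cell, [p] rings inside a small window and all other marks ring after it,
so that [p] wins. The event is a product event for the clocks, and ties cannot
occur on it. *)
Let cell p s h k := C `&` [set w | forall p', window p s h k p' (tau n p' w)].

Let rN p : (0 < r v p)%R. Proof. exact: rate_gt0. Qed.

Let qr p : (\sum_(p' | p' != p) r v p' = q v - r v p)%R.
Proof. by rewrite /total_rate [X in _ = (X - _)%R](bigD1 p)//= [X in _ = X]addrC addKr. Qed.

Let measure_cell p s h k : (0 <= s)%R -> (0 < h)%R ->
  P (cell p s h k) = P C * (win_cell (q v) (r v p) s h k)%:E.
Proof.
move=> s0 h0; rewrite /cell (box (measurable_window p s h k)) /window.
have t0 j : (0 <= s + j%:R * h)%R by rewrite addr_ge0// mulr_ge0// ltW.
congr (_ * _); rewrite (bigD1 p)//= eqxx exponential_itv//; last first.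
  by rewrite lerD2l ler_wpM2r ?ler_nat// ltW.
rewrite (eq_bigr (fun p' => (expR (- r v p' * (s + k.+1%:R * h)))%:E)); last first.
  by move=> p' /negPf ->; rewrite exponential_tail.
by rewrite prodEFin -EFinM -expR_sum -mulr_suml sumrN qr.
Qed.

Let cell_sub p s h k : (0 <= s)%R -> (0 < h)%R -> cell p s h k `<=` W p s.
Proof.
move=> s0 h0 w [Cw cw]; rewrite WE.
have := cw p; rewrite /window eqxx/= in_itv/= => /andP[lo hi].
have s_lo : (s <= s + k%:R * h)%R by rewrite lerDl mulr_ge0// ltW.
have far p' : p' != p -> (tau n p w < tau n p' w)%R.
  move=> /negPf pp'; have := cw p'; rewrite /window pp'/= in_itv/= andbT.
  exact: le_lt_trans.
have sp : (s < tau n p w)%R by exact: le_lt_trans lo.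
split; last exact: first_mark_uniq.
split => // p'; have [-> //|/far] := eqVneq p' p; exact: lt_trans.
Qed.

Let cells_disjoint p s h : (0 < h)%R -> trivIset setT (cell p s h).
Proof.
move=> h0; suff lt_disj i j : (i < j)%N -> cell p s h i `&` cell p s h j = set0.
  apply/trivIsetP => i j _ _; rewrite neq_ltn => /orP[/lt_disj//|/lt_disj].
  by rewrite setIC.
move=> ij; apply/seteqP; split => // w [[_ /(_ p) ci] [_ /(_ p)]].
move: ci; rewrite /window eqxx/= !in_itv/= => /andP[_ hi] /andP[lo _].
have := lt_le_trans lo hi; rewrite ltrD2l ltr_pM2r// ltr_nat.
by rewrite ltnS leqNgt ij.
Qed.

Let measurable_cell p s h k : measurable (cell p s h k).
Proof.
apply: measurableI => //.
rewrite (_ : [set w | _] =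
    \bigcap_(p' in [set: mark N]) (tau n p' @^-1` window p s h k p')).
  apply: fin_bigcap_measurable; first exact: finite_finset.
  by move=> p' _; exact: mtau.
by apply/seteqP; split => w cw p' => [_|]; exact: cw.
Qed.

(** Sum over disjoint cells and refine the mesh. *)
Let race_ge0 p s : (0 <= s)%R ->
  P C * (r v p / q v * expR (- q v * s))%:E <= P (W p s).
Proof.
move=> s0; have q0 := total_rate_gt0 beta hN v.
rewrite -(fineK (fin_num_measure P _ mC)) -(fineK (fin_num_measure P _ (mW p s))).
rewrite -EFinM lee_fin; apply: le_of_arch_bounds.
  by rewrite !mulr_ge0 ?fine_ge0 ?expR_ge0 ?invr_ge0// ltW.
move=> j; have [h h0 [K HK]] := sum_win_cells s j q0 (rN p).
apply: (@le_trans _ _ (fine (P C) * \sum_(k < K) win_cell (q v) (r v p) s h k)%R).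
  by rewrite -(mulrA (fine (P C))); apply: ler_wpM2l => //; exact: fine_ge0.
rewrite -lee_fin EFinM !fineK ?fin_num_measure//.
rewrite -sumEFin ge0_sume_distrr; last first.
  move=> k _; rewrite lee_fin /win_cell mulr_ge0 ?expR_ge0// subr_ge0 ler_expR.
  rewrite !mulNr lerN2 ler_wpM2l ?(ltW (rN p))// lerD2l ler_wpM2r ?(ltW h0)//.
  by rewrite ler_nat.
rewrite (eq_bigr (fun k : 'I_K => P (cell p s h k))); last first.
  by move=> k _; rewrite measure_cell.
rewrite -(@measure_bigsetU _ _ _ P)//; last exact/sub_trivIset/cells_disjoint.
apply: le_measure; rewrite ?inE//; first exact: bigsetU_measurable.
by rewrite -bigcup_mkord; apply: bigcup_sub => k _; exact: cell_sub.
Qed.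

(** The cells give a lower bound for each possible winner. The bounds add up to the
probability that all clocks ring after [s], so every one of them is an equality;
in particular ties need no separate treatment. *)
Lemma race p s :
  P (W p s) = P C * (r v p / q v * tail (q v) s)%:E.
Proof.
have q0 := total_rate_gt0 beta hN v.
pose E := C `&` [set w | forall p', (s < tau n p' w)%R].
have mE : measurable E.
  apply: measurableI => //.
  rewrite (_ : [set w | _] = \bigcap_(p' in [set: mark N]) (tau n p' @^-1` `]s, +oo[)).
    by apply: fin_bigcap_measurable => [|p' _]; [exact: finite_finset|exact: mtau].
  by apply/seteqP; split => w sw p' => [_|]; [|have := sw p' I];
    rewrite /= in_itv/= andbT.
have PE : P E = P C * (tail (q v) s)%:E.
  rewrite /E (_ : [set w | _] = [set w | forall p', `]s, +oo[%classic (tau n p' w)]).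
    rewrite (box (Y := fun=> `]s, +oo[%classic))//; congr (_ * _).
    rewrite (eq_bigr (fun p' => (tail (r v p') s)%:E)); last first.
      by move=> p' _; rewrite exponential_ray.
    by rewrite prodEFin -expR_sum -mulr_suml sumrN.
  by apply/seteqP; split => w sw p'; have := sw p'; rewrite /= in_itv/= andbT.
pose rho1 o := if o is Some p' then P C * (r v p' / q v * tail (q v) s)%:E else 0.
pose rho2 o := P (E `&` mark_at n @^-1` [set o]).
have r0 p' : (0 <= r v p' / q v * tail (q v) s)%R.
  by apply: mulr_ge0; [apply: divr_ge0; exact: ltW|exact: expR_ge0].
have rho10 o : 0 <= rho1 o by case: o => [p'|]//=; rewrite mule_ge0// lee_fin.
have m2 : mass rho2 = P E.
  rewrite [RHS](measure_esum P (Z := mark_at n))// => o.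
  by apply: measurableI => //; exact: measurable_mark_at.
have m1 : mass rho1 = P E.
  rewrite PE.
  rewrite /mass esum_option//.
  rewrite /rho1 -ge0_sume_distrr; last by move=> p' _; rewrite lee_fin.
  congr (_ * _); rewrite sumEFin -mulr_suml -mulr_suml -/(total_rate beta v).
  by rewrite divff ?mul1r// gt_eqF.
rewrite WE -/E -/(rho2 (Some p)) -/(rho1 (Some p)); apply/esym.
apply: esum_squeeze => //; last first.
- by rewrite m2 (le_lt_trans (probability_le1 _ mE))// ltry.
- by rewrite m1 m2.
case=> [p'|]; last exact: measure_ge0.
rewrite /rho2 -WE; apply: (@le_trans _ _ (P (W p' (Num.max s 0%R)))).
  by apply: race_ge0; rewrite le_max lexx orbT.
apply: le_measure; rewrite ?inE//; apply: setIS => w /=.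
by rewrite !in_itv/= !andbT; apply: le_lt_trans; rewrite le_max lexx.
Qed.

End Event.

Let mZ n V : measurable (Z n @^-1` V). Proof. exact: measurable_Z. Qed.

Let mT n (A : set R) : measurable A -> measurable (T n @^-1` A).
Proof. by move=> mA; rewrite -[_ @^-1` _]setTI; exact: measurable_T. Qed.

Let mH n (A : set R) : measurable A -> measurable (H n @^-1` A).
Proof. by move=> mA; rewrite -[_ @^-1` _]setTI; exact: measurable_H. Qed.

Let q0 v : (0 < q v)%R := total_rate_gt0 beta hN v.

(** * The forward equation *)

Lemma mark_at_some n w : exists p, mark_at n w = Some p.
Proof.
rewrite /mark_at /first_mark; case: pickP => [p _|none]; first by exists p.
pose e p := tau n p w.
have [p _ pmin] := @Order.TotalTheory.arg_minP _ R (mark N) (Ordinal hN, true) predT e isT.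
have := none p; rewrite /= (_ : [forall _, _] = true)//.
by apply/forallP => p'; exact: pmin.
Qed.

Lemma jump_timeS n w : (T n.+1 w = T n w + H n w)%R.
Proof. by rewrite /jump_time big_ord_recr. Qed.

Lemma jump_time0 w : T 0 w = 0%R.
Proof. by rewrite /jump_time big_ord0. Qed.

Lemma jump_chainS n w p : mark_at n w = Some p -> Z n.+1 w = express p (Z n w).
Proof. by move=> /= mw; rewrite -[first_mark _]/(mark_at n w) mw. Qed.

(** The event that the [n.+1]-st jump is the expression [p] made in the list [v]. *)
Definition branch n v p : set Omega := Z n @^-1` [set v] `&` mark_at n @^-1` [set Some p].

Lemma measurable_branch n v p : measurable (branch n v p).
Proof. by apply: measurableI => //; exact: measurable_mark_at. Qed.

Let win_ge0 (v : state N) (p : mark N) : (0 <= r v p / q v)%R.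
Proof. by rewrite divr_ge0// ltW// rate_gt0. Qed.

Lemma measurable_TH (E : set (R * R)) n : measurable E ->
  measurable ((fun w => (T n w, H n w)) @^-1` E).
Proof.
move=> mE; rewrite -[_ @^-1` _]setTI.
have := @measurable_fun_pair _ _ _ Omega R R _ _ (measurable_T n) (measurable_H n).
by apply.
Qed.

(** Given that the chain is in [v] after [n] jumps and that [p] wins, the next
holding time is exponential and independent of the time of the [n]-th jump. *)
Lemma step_law n v p (E : set (R * R)) : measurable E ->
  P (branch n v p `&` (fun w => (T n w, H n w)) @^-1` E) =
  (r v p / q v)%:E * \int[P]_w (exponential_prob (q v) (xsection E (T n w)) *
    (\1_(Z n @^-1` [set v]) w)%:E).
Proof.
move=> mE.
pose nu := exponential_law (q0 v).
have mnu : measurable_fun setT (fun w => nu (xsection E (T n w))).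
  have := measurable_fun_xsection nu mE.
  by move=> /measurableT_comp; apply; exact: measurable_T.
rewrite -[X in _ = _ * X]/(\int[P]_w (nu (xsection E (T n w)) * _)) -(integral_mrestr P (mZ n [set v]))//.
rewrite setIC.
have := @joint_law R _ Omega (mrestr P (measurable_branch n v p)) (mrestr P (mZ n [set v]))
  nu (NngNum (win_ge0 v p)) (T n) (H n) (measurable_T n) (measurable_H n).
move=> /(_ _ E mE); apply => A s mA; rewrite /mrestr/=.
rewrite exponential_ray//.
have := race v (past_jump_time (n := n) mA) p s.
rewrite EFinM muleCA => raceE; apply: etrans raceE; congr (P _).
by rewrite /branch; apply/seteqP; split => w /=; tauto.
Qed.

Lemma chain_law n v (E : set (R * R)) : measurable E ->
  P (Z n @^-1` [set v] `&` (fun w => (T n w, H n w)) @^-1` E) =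
  \int[P]_w (exponential_prob (q v) (xsection E (T n w)) *
    (\1_(Z n @^-1` [set v]) w)%:E).
Proof.
move=> mE; have mTH := measurable_TH n mE.
set I := \int[P]_w _.
have I0 : 0 <= I.
  apply: integral_ge0 => w _; apply: mule_ge0; last by rewrite lee_fin.
  exact: (measure_ge0 (exponential_law (q0 v))).
rewrite (measure_esum P (Z := mark_at n)); last first.
  by move=> o; apply: measurableI; [exact: measurableI|exact: measurable_mark_at].
rewrite esum_option//; last first.
  rewrite (_ : _ `&` _ = set0) ?measure0//.
  apply/seteqP; split => // w [_ /= mw].
  by have [p] := mark_at_some n w; rewrite mw.
rewrite (eq_bigr (fun p => (r v p / q v)%:E * I)); last first.
  move=> p _; rewrite -step_law//; congr (P _).
  by rewrite /branch; apply/seteqP; split => w /=; tauto.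
rewrite -ge0_sume_distrl; last by move=> p _; rewrite lee_fin.
rewrite sumEFin -mulr_suml -/(total_rate beta v) divff ?mul1e//.
by rewrite gt_eqF.
Qed.

(** The probability that at time [t] the process has made [n] jumps and sits in
[v]. *)
Definition occ n v (t : R) : \bar R :=
  P (Z n @^-1` [set v] `&` [set w | (T n w <= t < T n.+1 w)%R]).

(** The probability of no jump up to time [t] after entering [v] at time [s]; it is
0 if [s] is later than [t]. *)
Definition survival (v : state N) (t s : R) : R :=
  if (s <= t)%R then expR (- q v * (t - s)) else 0%R.

Lemma survival_ge0 v t s : (0 <= survival v t s)%R.
Proof. by rewrite /survival; case: ifP => // _; exact: expR_ge0. Qed.

Lemma measurable_survival v : measurable_fun setT
  (fun z : R * R => survival v z.1 z.2).
Proof.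
apply: measurable_fun_ifT => //.
- by apply: measurable_fun_ler; [exact: measurable_snd|exact: measurable_fst].
- apply: measurableT_comp => //; apply: measurable_funM => //.
  by apply: measurable_funB; [exact: measurable_fst|exact: measurable_snd].
Qed.

Lemma measurable_survivalr v t : measurable_fun setT (survival v t).
Proof.
exact: (measurableT_comp (measurable_survival v) (@measurable_pair1 _ _ _ _ t)).
Qed.

Lemma occE n v t :
  occ n v t = \int[P]_w ((survival v t (T n w))%:E * (\1_(Z n @^-1` [set v]) w)%:E).
Proof.
pose E : set (R * R) := [set z | (z.1 <= t < z.1 + z.2)%R].
have mE : measurable E.
  have mb : measurable_fun setT (fun z : R * R => (z.1 <= t < z.1 + z.2)%R).
    apply: measurable_and.
      by apply: measurable_fun_ler => //; exact: measurable_fst.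
    apply: measurable_fun_ltr => //; apply: measurable_funD.
      exact: measurable_fst.
    exact: measurable_snd.
  by have := mb measurableT [set true] I; rewrite setTI.
rewrite /occ (_ : [set w | _] = (fun w => (T n w, H n w)) @^-1` E); last first.
  by apply/seteqP; split => w /=; rewrite jump_timeS.
rewrite chain_law//; apply: eq_integral => w _; congr (_ * _).
have [Tt|tT] := boolP (T n w <= t)%R.
  rewrite (_ : xsection _ _ = `]t - T n w, +oo[%classic)%R; last first.
    apply/seteqP; split => y; rewrite /xsection/= inE/= in_itv/= andbT ltrBlDl.
      by case/andP.
    by move=> yt; apply/andP; split.
  by rewrite exponential_tail ?subr_ge0// /survival Tt.
rewrite (_ : xsection _ _ = set0); last first.
  apply/seteqP; split => y //; rewrite /xsection/= inE => /andP[/= Tt _].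
  by rewrite Tt in tT.
by rewrite /survival (negPf tT) /exponential_prob integral_set0.
Qed.

Lemma occ_fin n v t : occ n v t \is a fin_num.
Proof.
apply: fin_num_measure; apply: measurableI => //.
rewrite (_ : [set w | _] = (fun w => (T n w <= t < T n.+1 w)%R) @^-1` [set true])//.
rewrite -[_ @^-1` _]setTI.
suff mb : measurable_fun setT (fun w => (T n w <= t < T n.+1 w)%R) by exact: mb.
apply: measurable_and.
  by apply: measurable_fun_ler => //; exact: measurable_T.
by apply: measurable_fun_ltr => //; exact: measurable_T.
Qed.

Lemma occ_ge0 n v t : 0 <= occ n v t.
Proof. exact: measure_ge0. Qed.

(** The integrand of the formula for [occ], as a function on the product of the
probability space and the time axis, for use in Tonelli's theorem. *)
Let weight n v (z : Omega * R) : R :=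
  survival v z.2 (T n z.1) * \1_(Z n @^-1` [set v]) z.1.

Let measurable_weight n v : measurable_fun setT (weight n v).
Proof.
apply: measurable_funM.
  have mp : measurable_fun setT (fun z : Omega * R => (z.2, T n z.1)).
    apply: measurable_fun_pair; first exact: measurable_snd.
    by apply: measurableT_comp; [exact: measurable_T|exact: measurable_fst].
  exact: (measurableT_comp (measurable_survival v) mp).
apply: measurableT_comp; last exact: measurable_fst.
exact: measurable_indic.
Qed.

Let weight_ge0 n v z : (0 <= weight n v z)%R.
Proof. by rewrite mulr_ge0// survival_ge0. Qed.

Lemma measurable_occ n v : measurable_fun setT (occ n v).
Proof.
have -> : occ n v = fun t => \int[P]_w (weight n v (w, t))%:E.
  by apply/funext => t; rewrite occE.
apply: (measurable_fun_fubini_tonelli_G (fun z => (weight n v z)%:E)).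
- by apply/measurable_EFinP; exact: measurable_weight.
- by move=> z; rewrite lee_fin.
Qed.

Lemma exponential_pdf_survival (v : state N) (x s : R) :
  exponential_pdf (q v) (s - x)%R = (q v * survival v s x)%R.
Proof.
rewrite /survival -subr_ge0; case: ifPn => [sx|].
  by rewrite exponential_pdfE.
by rewrite -ltNge => sx; rewrite lt0_exponential_pdf// mulr0.
Qed.

(** The instant of the jump along a branch has a density: the rate of the branch
times the probability of being in [v] just before. Translate the exponential
density by the time of the previous jump and exchange the integrals. *)
Lemma branch_density n v p (A : set R) : measurable A ->
  P (branch n v p `&` T n.+1 @^-1` A) =
  \int[leb]_(s in A) ((r v p)%:E * occ n v s).
Proof.
move=> mA; pose E : set (R * R) := [set z | A (z.1 + z.2)%R].
have mE : measurable E.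
  have ma : measurable_fun setT (fun z : R * R => (z.1 + z.2)%R).
    by apply: measurable_funD; [exact: measurable_fst|exact: measurable_snd].
  by have := ma measurableT A mA; rewrite setTI.
rewrite (_ : T n.+1 @^-1` A = (fun w => (T n w, H n w)) @^-1` E); last first.
  by apply/seteqP; split => w /=; rewrite /E/= jump_timeS.
rewrite step_law//.
pose G (z : Omega * R) : \bar R := (q v * weight n v z * \1_A z.2)%:E.
have mG : measurable_fun setT G.
  apply/measurable_EFinP; apply: measurable_funM.
    by apply: measurable_funM => //; exact: measurable_weight.
  by apply: measurableT_comp; [exact: measurable_indic|exact: measurable_snd].
have G0 z : 0 <= G z.
  by rewrite lee_fin mulr_ge0// mulr_ge0 ?weight_ge0// ltW.
rewrite (eq_integral (fun w => \int[leb]_s G (w, s))); last first.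
  move=> w _.
  rewrite (_ : xsection E (T n w) = (fun y => T n w + y)%R @^-1` A); last first.
    by apply/seteqP; split => y; rewrite /xsection/= inE.
  rewrite /exponential_prob (@integral_shift R (T n w) A
    (fun y => (exponential_pdf (q v) y)%:E))//; last 2 first.
  - by apply/measurable_EFinP; exact: measurable_exponential_pdf.
  - by move=> y; rewrite lee_fin exponential_pdf_ge0// ltW.
  rewrite integral_mkcond /G /weight/= indicE.
  case: (w \in _); rewrite ?mule1 ?mule0.
    apply: eq_integral => s _; rewrite patchE exponential_pdf_survival indicE.
    by case: (s \in A); rewrite ?mulr1 ?mulr0.
  by rewrite integral0_eq// => s _; rewrite !mulr0 mul0r.
rewrite (@fubini_tonelli _ _ _ _ _ P leb G mG G0).
rewrite -ge0_integralZl//; last 3 first.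
- exact: (measurable_fun_fubini_tonelli_G G).
- by move=> s _; exact: integral_ge0.
- by rewrite lee_fin.
rewrite [RHS]integral_mkcond; apply: eq_integral => s _.
rewrite (eq_integral (fun w => (q v * \1_A s)%:E * (weight n v (w, s))%:E)); last first.
  by move=> w _; rewrite /G/= -EFinM; congr (_%:E); ring.
rewrite ge0_integralZl//; last 3 first.
- apply/measurable_EFinP.
  exact: (measurableT_comp (@measurable_weight n v) (@measurable_pair2 _ _ _ _ s)).
- by move=> w _; rewrite lee_fin.
- by rewrite lee_fin mulr_ge0// ltW.
rewrite -occE muleA patchE indicE.
case: (s \in A); last by rewrite mulr0 mule0 mul0e.
by rewrite mulr1 -EFinM divfK// gt_eqF.
Qed.

(** The forward equation. Being in [v'] after [n.+1] jumps means that one branch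
leads there at some time [s] and that no jump follows until [t]. *)
Lemma occS n v' t :
  occ n.+1 v' t = \esum_(v in [set: state N])
    ((jump_rate beta v v')%:E * \int[leb]_s ((survival v' t s)%:E * occ n v s)).
Proof.
pose g w : \bar R := (survival v' t (T n.+1 w))%:E.
have mg : measurable_fun setT g.
  apply/measurable_EFinP.
  exact: (measurableT_comp (measurable_survivalr v' t) (measurable_T n.+1)).
have g0 w : 0 <= g w by rewrite lee_fin survival_ge0.
have mgb v p : measurable_fun setT (fun w => g w * (\1_(branch n v p) w)%:E).
  apply: emeasurable_funM => //; apply/measurable_EFinP; apply: measurable_indic.
  exact: measurable_branch.
have gb0 v p w : 0 <= g w * (\1_(branch n v p) w)%:E by rewrite mule_ge0// lee_fin.
rewrite occE (eq_integral (fun w => \esum_(v in [set: state N])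
    \sum_p (if express p v == v' then g w * (\1_(branch n v p) w)%:E else 0))); last first.
  move=> w _; have [p0 mw] := mark_at_some n w.
  rewrite (eq_esum (b := fun v => \sum_(p | express p v == v')
    g w * (\1_(branch n v p) w)%:E)); last by move=> v _; rewrite -big_mkcond.
  rewrite (esum_pick (u := Z n w)); last 2 first.
  - move=> v vZ; rewrite big1// => p _; rewrite indicE memNset ?mule0//.
    by move=> [/= Zv _]; rewrite Zv eqxx in vZ.
  - by apply: sume_ge0 => p _.
  have brE p : (w \in branch n (Z n w) p) = (p == p0).
    apply/idP/eqP => [/set_mem[_ /=]|->]; first by rewrite mw => -[].
    by apply/mem_set; split.
  have inZ : (w \in Z n.+1 @^-1` [set v']) = (express p0 (Z n w) == v').
    apply/idP/eqP => [/set_mem zw|e].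
      by rewrite -(jump_chainS mw); exact: zw.
    by apply/mem_set; exact: etrans (jump_chainS mw) e.
  rewrite indicE inZ; have [e|e] := boolP (express p0 (Z n w) == v').
    rewrite (bigD1 p0)//= big1 ?adde0; first by rewrite indicE brE eqxx.
    by move=> p /andP[_ /negPf pp0]; rewrite indicE brE pp0 mule0.
  rewrite mule0 big1// => p pv; rewrite indicE brE.
  by case: eqP => [pE|_]; [rewrite -pE pv in e|rewrite mule0].
rewrite integral_esum//; last 2 first.
- by move=> v; apply: emeasurable_sum => p; case: (express p v == v').
- by move=> v w; apply: sume_ge0 => p _; case: ifP.
apply: eq_esum => v _.
rewrite ge0_integral_sum//; last 2 first.
- by move=> p; case: (express p v == v').
- by move=> p w _; case: ifP.
rewrite /jump_rate -sumEFin ge0_sume_distrl; last first.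
  by move=> p _; rewrite lee_fin ltW// rate_gt0.
rewrite [RHS]big_mkcond; apply: eq_bigr => p _.
case: (express p v == v'); last by rewrite integral0.
have mT1 : measurable_fun setT (T n.+1 : Omega -> measurableTypeR R) :=
  measurable_T n.+1.
rewrite -(integral_mrestr P (measurable_branch n v p))//.
have msv : measurable_fun setT (fun s : R => (survival v' t s)%:E).
  by apply/measurable_EFinP; exact: measurable_survivalr.
transitivity (\int[image_measure (mrestr P (measurable_branch n v p)) mT1]_s
   (survival v' t s)%:E).
  rewrite ge0_integral_pushforward//.
  by move=> s _; rewrite lee_fin survival_ge0.
rewrite [LHS](@integral_density _ _ _ leb _ (fun s => (r v p)%:E * occ n v s))//.
- under [LHS]eq_integral => s _ do rewrite muleCA.
  rewrite ge0_integralZl//; last 3 first.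
  + apply: emeasurable_funM => //; exact: measurable_occ.
  + by move=> s _; rewrite mule_ge0 ?occ_ge0// lee_fin survival_ge0.
  + by rewrite lee_fin ltW// rate_gt0.
- by apply: emeasurable_funM => //; exact: measurable_occ.
- by move=> s; rewrite mule_ge0 ?occ_ge0// lee_fin ltW// rate_gt0.
- move=> A mA; rewrite -branch_density//= /pushforward /mrestr/=.
  by rewrite setIC.
- by move=> s; rewrite fin_numM// occ_fin.
- by move=> s; rewrite lee_fin survival_ge0.
Qed.

Lemma occ0 v t : occ 0 v t = if v == u then (survival v t 0)%:E else 0.
Proof.
rewrite occE.
under eq_integral => w _ do rewrite jump_time0.
have [->|vu] := eqVneq v u.
  rewrite (_ : Z 0 @^-1` [set u] = setT); last by apply/seteqP; split.
  under eq_integral => w _ do rewrite indicT mule1.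
  by rewrite integral_cst//; exact: etrans (congr1 _ (probability_setT P)) (mule1 _).
apply: integral0_eq => w _; rewrite indicE memNset ?mule0//= => uv.
by rewrite uv eqxx in vu.
Qed.

Lemma occ_lt0 n v t : (t < 0)%R -> occ n v t = 0.
Proof.
elim: n v t => [|n IH] v t t0.
  by rewrite occ0 /survival leNgt t0; case: ifP.
rewrite occS esum1// => w _.
rewrite integral0_eq ?mule0// => s _; rewrite /survival.
have [st|_] := boolP (s <= t)%R; last by rewrite mul0e.
by rewrite IH ?mule0// (le_lt_trans st).
Qed.

(** * Non-explosion *)

Lemma holding_pos n : P (H n @^-1` `]0%R, +oo[%classic) = 1.
Proof.
rewrite -(probability_setT P) (measure_esum P (Z := Z n)); last first.
  by move=> v; apply: measurableI => //; exact: mH.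
rewrite [RHS](measure_esum P (Z := Z n)); last by move=> v; rewrite setTI.
apply: eq_esum => v _; rewrite setTI.
pose E : set (R * R) := setT `*` `]0%R, +oo[%classic.
have mE : measurable E by exact: measurableX.
rewrite (_ : _ `&` _ = Z n @^-1` [set v] `&` (fun w => (T n w, H n w)) @^-1` E); last first.
  by rewrite /E; apply/seteqP; split => w /=; tauto.
rewrite [LHS](chain_law n v mE).
under eq_integral => w _.
  rewrite in_xsectionX ?inE// exponential_tail// mulr0 expR0 mul1e.
  over.
by rewrite integral_indic// setIT.
Qed.

(** Holding times are positive only almost surely; on this event of probability 1
the jump times increase and exactly one of the intervals between them contains a
given time. *)
Definition good : set Omega := [set w | forall k, (0 < H k w)%R].

Let goodE : good = \bigcap_k (H k @^-1` `]0%R, +oo[%classic).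
Proof.
apply/seteqP; split => w gw k => [_|]; [|have := gw k I];
  by rewrite /= in_itv/= andbT.
Qed.

Lemma measurable_good : measurable good.
Proof. by rewrite goodE; apply: bigcapT_measurable => k; exact: mH. Qed.

Lemma measure_good A : measurable A -> P (A `&` good) = P A.
Proof.
move=> mA; have mg := measurable_good.
have g0 : P (~` good) = 0.
  apply: measure_negligible; first exact: measurableC.
  rewrite goodE setC_bigcap; apply: negligible_bigcup => k.
  apply/negligibleP; first by apply: measurableC; exact: mH.
  have mHk := mH k (measurable_itv `]0%R, +oo[).
  exact: etrans (probability_setC P mHk) (etrans (congr1 _ (congr1 _ (holding_pos k))) (subee _)).
rewrite -[in RHS](setIT A) -(setUv good) setIUr measureU0//.
- exact: measurableI.
- by apply: measurableI => //; exact: measurableC.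
- apply: (subset_measure0 _ _ _ g0); [|exact: measurableC|by []].
  by apply: measurableI => //; exact: measurableC.
Qed.

Lemma jump_time_ge0 n w : good w -> (0 <= T n w)%R.
Proof. by move=> gw; apply: sumr_ge0 => k _; exact/ltW/gw. Qed.

Lemma jump_time_homo w : good w -> {homo T ^~ w : m n / (m <= n)%N >-> (m <= n)%R}.
Proof.
move=> gw; apply: homo_leq => [//|x y z|n]; first exact: le_trans.
by rewrite jump_timeS lerDl ltW.
Qed.

(** The measure that the [n]-th jump puts on its target when it occurs before
[t]. *)
Definition early t n v : \bar R := P (Z n @^-1` [set v] `&` T n @^-1` `]-oo, t]%classic).

Local Notation K := (@embedded R N beta).
Let K0 := @embedded_ge0 R N beta hN.
Let K1 := @mass_embedded R N beta hN.

Let early_ge0 t n v : 0 <= early t n v. Proof. exact: measure_ge0. Qed.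

Definition stay (t : R) (v : state N) : R := expR (- q v * t).

Let stay_ge0 t v : (0 <= stay t v)%R. Proof. exact: expR_ge0. Qed.

Let stay_le1 (t : R) v : (0 <= t)%R -> (stay t v <= 1)%R.
Proof. by move=> t0; rewrite expR_le1 mulNr oppr_le0 mulr_ge0// ltW. Qed.

(** The embedded kernel weakened at each list by the probability that a holding
time there is shorter than [t]. *)
Definition brake t (v w : state N) : \bar R := (1 - stay t v)%:E * K v w.

Let leave_ge0 t v : (0 <= t)%R -> (0 <= 1 - stay t v)%R.
Proof. by move=> t0; rewrite subr_ge0 stay_le1. Qed.

Let brake_ge0 t v w : (0 <= t)%R -> 0 <= brake t v w.
Proof. by move=> t0; rewrite mule_ge0// lee_fin leave_ge0. Qed.

(** If the next jump is to occur before [t], then the present one does and the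
holding time is less than [t]. *)
Lemma early_recl t n v' : (0 <= t)%R ->
  early t n.+1 v' <= push (brake t) (early t n) v'.
Proof.
move=> t0; set E := Z n.+1 @^-1` [set v'] `&` T n.+1 @^-1` `]-oo, t]%classic.
have mE : measurable E by apply: measurableI => //; exact: mT.
rewrite /early -/E -measure_good// (measure_esum P (Z := Z n)); last first.
  by move=> v; do 2 apply: measurableI => //; exact: measurable_good.
apply: le_esum => v _.
rewrite (measure_esum P (Z := mark_at n)); last first.
  move=> o; apply: measurableI; last exact: measurable_mark_at.
  by do 2 apply: measurableI => //; exact: measurable_good.
rewrite esum_option//; last first.
  rewrite (_ : _ `&` _ = set0) ?measure0//.
  apply/seteqP; split => // w [_ /= mw].
  by have [p] := mark_at_some n w; rewrite mw.
have -> : early t n v * brake t v v' = \sum_(p | express p v == v')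
    (r v p / q v * (1 - stay t v))%:E * early t n v.
  rewrite muleC -ge0_sume_distrl; last first.
    by move=> p _; rewrite lee_fin mulr_ge0 ?leave_ge0 ?win_ge0.
  congr (_ * _); rewrite sumEFin -!mulr_suml /brake /embedded -EFinM.
  by congr (_%:E); rewrite mulrC.
rewrite [leRHS]big_mkcond/=; apply: lee_sum => p _.
have [pv|pv] := boolP (express p v == v'); last first.
  rewrite (_ : _ `&` _ = set0) ?measure0//.
  apply/seteqP; split => // w [[[[Zw _] _] /= Zv] mw].
  have := etrans (esym (jump_chainS mw)) Zw; rewrite Zv => pv'.
  by rewrite pv' eqxx in pv.
pose S : set (R * R) := `]-oo, t]%classic `*` `]-oo, t]%classic.
have mS : measurable S by exact: measurableX.
have le_branch : P (E `&` good `&` Z n @^-1` [set v] `&` mark_at n @^-1` [set Some p]) <=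
    P (branch n v p `&` (fun w => (T n w, H n w)) @^-1` S).
  apply: le_measure; rewrite ?inE.
  - apply: measurableI; last exact: measurable_mark_at.
    by do 2 apply: measurableI => //; exact: measurable_good.
  - by apply: measurableI; [exact: measurable_branch|exact: measurable_TH].
  - move=> w [[[[_ Tt] gw] Zv] mw]; split; first by split.
    move: Tt; rewrite /= !in_itv/= jump_timeS => Tt.
    have T0 := jump_time_ge0 n gw; have H0 := ltW (gw n).
    split; rewrite /= in_itv/=; apply: le_trans Tt; first by rewrite lerDl.
    by rewrite lerDr.
apply: (le_trans le_branch); rewrite (step_law)//.
rewrite [in leRHS]EFinM -[leRHS]muleA; apply: lee_wpmul2l.
  by rewrite lee_fin divr_ge0// ltW// rate_gt0.
rewrite (eq_integral (fun w => (1 - stay t v)%:E *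
    (\1_(Z n @^-1` [set v] `&` T n @^-1` `]-oo, t]%classic) w)%:E)); last first.
  move=> w _; rewrite indicI/=.
  have [Tt|tT] := boolP (T n w \in `]-oo, t]).
    have -> : \1_(T n @^-1` `]-oo, t]%classic) w = 1%R :> R by rewrite indicE mem_set.
    rewrite in_xsectionX ?inE//.
    rewrite (_ : `]-oo, t]%classic = ~` `]t, +oo[%classic); last by rewrite setCitvr.
    rewrite (probability_setC (exponential_law (q0 v)))//= exponential_tail//.
    by rewrite mulr1 /stay EFinB.
  rewrite notin_xsectionX ?notin_setE; last exact/negP.
  rewrite /exponential_prob integral_set0 mul0e.
  have -> : \1_(T n @^-1` `]-oo, t]%classic) w = 0%R :> R.
    by rewrite indicE memNset//; exact/negP.
  by rewrite mulr0 mule0.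
rewrite ge0_integralZl//.
- by rewrite integral_indic ?setIT//; apply: measurableI => //; exact: mT.
- apply/measurable_EFinP; apply: measurable_indic.
  by apply: measurableI => //; exact: mT.
- by rewrite lee_fin leave_ge0.
Qed.

Lemma mass_early t n : mass (early t n) = P (T n @^-1` `]-oo, t]%classic).
Proof.
rewrite [RHS](measure_esum P (Z := Z n)).
  by apply: eq_esum => v _; rewrite /early setIC.
by move=> v; apply: measurableI => //; exact: mT.
Qed.

Lemma early_iter t n k v : (0 <= t)%R ->
  early t (n + k) v <= iter k (push K) (early t n) v.
Proof.
move=> t0; elim: k v => [|k IH] v; first by rewrite addn0.
rewrite addnS; apply: (le_trans (early_recl _ _ t0)).
apply: (@le_trans _ _ (push K (early t (n + k)) v)); last exact: le_push.
apply: le_esum => w _; apply: lee_wpmul2l => //.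
rewrite -[leRHS]mul1e; apply: lee_wpmul2r => //.
by rewrite lee_fin gerBl stay_ge0.
Qed.

(** A single list [l] already accounts for a definite loss of mass. *)
Lemma mass_brake t (rho : state N -> \bar R) l : (0 <= t)%R ->
  (forall v, 0 <= rho v) ->
  mass (push (brake t) rho) + rho l * (stay t l)%:E <= mass rho.
Proof.
move=> t0 rho0; have s0 v : 0 <= (stay t v)%:E by rewrite lee_fin.
have s1 v : 0 <= (1 - stay t v)%:E by rewrite lee_fin subr_ge0 stay_le1.
have -> : mass (push (brake t) rho) = mass (fun w => rho w * (1 - stay t w)%:E).
  rewrite /mass /push esum_swap; last first.
    by move=> v w; rewrite mule_ge0// brake_ge0.
  apply: eq_esum => w _; rewrite esumZl//; last by move=> v; exact: brake_ge0.
  by rewrite /brake esumZl// -/(mass _) K1 mule1.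
apply: (@le_trans _ _ (mass (fun w => rho w * (1 - stay t w)%:E) +
   mass (fun w => rho w * (stay t w)%:E))).
  apply: leeD => //; apply: (esum_term l (f := fun w => rho w * (stay t w)%:E)) => v.
  exact: mule_ge0.
rewrite /mass -esumD; last 2 first.
- by move=> v _; exact: mule_ge0.
- by move=> v _; exact: mule_ge0.
apply: le_esum => v _; rewrite -ge0_muleDr// -EFinD.
by rewrite subrK mule1.
Qed.

Hypothesis beta_ge0 : (0 <= beta)%R.

(** The mass is bounded by that of [2N] steps of the embedded chain followed by one
weakened step. The former leave at least the proportion [delta] at the ladder,
and the latter loses the proportion [exp (- q t)] of it. *)
Lemma early_contract t : (0 <= t)%R -> exists2 y : R, (0 <= y < 1)%R &
  exists M : nat, forall n, mass (early t (n + M)) <= y%:E * mass (early t n).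
Proof.
move=> t0; have [delta d0 hdelta] := embedded_doeblin hN beta_ge0.
pose l := ladder N; pose eps := (delta * stay t l)%R.
have eps0 : (0 < eps)%R by rewrite mulr_gt0// expR_gt0.
have d1 : (delta <= 1)%R.
  rewrite -lee_fin -(mass_iter_kernel (N + N) K0 K1 l).
  apply: (le_trans (hdelta l)); apply: (esum_term _ (f := iter_kernel K (N + N) l)).
  by move=> v; exact: iter_kernel_ge0.
exists (1 - eps)%R.
  by rewrite subr_ge0 gtrBl eps0 andbT /eps mulr_ile1// ?stay_le1// ltW.
exists (N + N).+1 => n.
set g := mass (early t n).
have gfin : g \is a fin_num by rewrite /g mass_early fin_num_measure//; exact: mT.
have g0 : 0 <= g by exact: mass_ge0.
pose rho := push (iter_kernel K (N + N)) (early t n).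
have rho0 v : 0 <= rho v by apply: push_ge0 => // *; exact: iter_kernel_ge0.
have mrho : mass rho = g.
  by rewrite (@mass_push _ _ _ _ 1) ?mule1//; [move=> *; exact: iter_kernel_ge0|exact: mass_iter_kernel].
have rhol : delta%:E * g <= rho l.
  rewrite muleC /g /mass -esumZr//; last by rewrite lee_fin ltW.
  by apply: le_esum => w _; exact: lee_wpmul2l.
have le1 : mass (early t (n + (N + N).+1)) <= mass (push (brake t) rho).
  apply: le_esum => v _; rewrite addnS; apply: (le_trans (early_recl _ _ t0)).
  apply: le_push => [*|w]; first exact: brake_ge0.
  by rewrite /rho push_iter_kernel//; exact: early_iter.
have le2 := mass_brake l t0 rho0.
rewrite EFinB muleBl ?fin_num_adde_defr// mul1e leeBrDr; last by rewrite fin_numM.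
rewrite -[leRHS]mrho; apply: le_trans le2; apply: leeD => //.
by rewrite /eps EFinM muleAC; apply: lee_wpmul2r; [rewrite lee_fin|].
Qed.

Lemma le_of_geometric (x y : R) : (0 <= y < 1)%R ->
  (forall j : nat, x <= y ^+ j)%R -> (x <= 0)%R.
Proof.
move=> /andP[y0 y1] le_xy.
have cy : (fun j => y ^+ j)%R @ \oo --> (0 : R)%R by apply: cvg_expr; rewrite ger0_norm.
rewrite -(cvg_lim _ cy)//; apply: limr_ge; first exact: cvgP cy.
exact: nearW.
Qed.

Lemma never_early t : P (\bigcap_n (T n @^-1` `]-oo, t]%classic)) = 0.
Proof.
have mcap s : measurable (\bigcap_n (T n @^-1` `]-oo, s]%classic)).
  by apply: bigcapT_measurable => n; exact: mT.
(* enlarging [t] enlarges the event *)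
wlog t0 : t / (0 <= t)%R => [th|].
  apply: (subset_measure0 _ _ _ (th (Num.max t 0%R) _)) => //.
    move=> w Tw n _; move: (Tw n I); rewrite /= !in_itv/= le_max => ->//.
  by rewrite le_max lexx orbT.
have [y y01 [M contract]] := early_contract t0.
have gj j : mass (early t (j * M)) <= (y ^+ j)%:E.
  elim: j => [|j IH]; first by rewrite expr0 mass_early probability_le1//; exact: mT.
  rewrite mulSnr exprS EFinM; apply: (le_trans (contract _)); apply: lee_wpmul2l => //.
  by rewrite lee_fin; case/andP: y01.
set x := P _; have xfin : x \is a fin_num by rewrite fin_num_measure.
have : (fine x <= 0)%R.
  apply: (le_of_geometric y01) => j; rewrite -lee_fin fineK//.
  apply: le_trans (gj j); rewrite mass_early; apply: le_measure; rewrite ?inE//.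
    exact: mT.
  by move=> w; apply.
rewrite -lee_fin fineK// => x_le0; apply/eqP; rewrite eq_le x_le0/=.
exact: measure_ge0.
Qed.

Definition unbounded : set Omega := [set w | forall t : R, exists m, (t < T m w)%R].

Let unboundedE :
  unbounded = ~` \bigcup_k \bigcap_n (T n @^-1` `]-oo, k%:R]%classic).
Proof.
apply/seteqP; split => w /=.
  move=> unb [k _ Ak]; have [m] := unb k%:R; rewrite ltNge => /negP; apply.
  by have := Ak m I; rewrite /= in_itv.
move=> nA t; apply: contrapT => nex; apply: nA.
exists (Num.truncn `|t|).+1 => // m _; rewrite /= in_itv/=.
apply: le_trans (ltW (truncnS_gt `|t|)); apply: le_trans (ler_norm t).
by rewrite leNgt; apply/negP => tT; apply: nex; exists m.
Qed.

Let measurable_early (k : nat) :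
  measurable (\bigcap_n (T n @^-1` `]-oo, k%:R]%classic)).
Proof. by apply: bigcapT_measurable => n; exact: mT. Qed.

Lemma measurable_unbounded : measurable unbounded.
Proof. by rewrite unboundedE; apply: measurableC; exact: bigcupT_measurable. Qed.

Lemma unbounded_jump_times : P unbounded = 1.
Proof.
rewrite unboundedE probability_setC; last exact: bigcupT_measurable.
rewrite (_ : P _ = 0) ?sube0//; apply: measure_negligible; first exact: bigcupT_measurable.
apply: negligible_bigcup => k; apply/negligibleP => //.
exact: never_early.
Qed.

(** This equality of events holds at every point, also where some holding time
fails to be positive: the first jump time exceeding [t] is preceded by one that
does not, since the sequence starts at 0. *)
Lemma process_exists_iff w :
  (forall t : R, (0 <= t)%R -> exists v, process u X t w = Some v) <->
  unbounded w.
Proof.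
split => [ex t|unb t t0].
  have := ex (Num.max t 0%R); rewrite le_max lexx orbT => /(_ isT)[v].
  rewrite /process; case: pselect => // -[m /andP[_ +]] _.
  by rewrite gt_max => /andP[tm _]; exists m.+1.
have exm : exists m, (t < T m w)%R := unb t.
rewrite /process; case: pselect => [h|nh]; first by eexists.
exfalso; apply: nh; case: (ex_minnP exm) => -[|m] tm min.
  by move: tm; rewrite jump_time0 ltNge t0.
exists m; rewrite tm andbT leNgt; apply/negP => /min.
by rewrite ltnn.
Qed.

Lemma sup_jump_times_iff w :
  ereal_sup [set (T m w)%:E | m in [set m : nat | (1 <= m)%N]] = +oo <->
  unbounded w.
Proof.
split => [supE t|unb].
  have : t%:E < ereal_sup [set (T m w)%:E | m in [set m : nat | (1 <= m)%N]].
    by rewrite supE ltry.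
  by move=> /ereal_sup_gt[_ [m _ <-]]; rewrite lte_fin => tm; exists m.
set S := ereal_sup _.
have leS m : (1 <= m)%N -> (T m w)%:E <= S.
  by move=> m1; apply: ereal_sup_ubound; exists m.
have [m] := unb (Num.max (fine S) 0%R); rewrite gt_max => /andP[Sm Tm].
have m1 : (1 <= m)%N.
  by case: m Tm {Sm} => //; rewrite jump_time0 ltxx.
move: (leS m m1) Sm; case: S {leS} => //= s.
by rewrite lee_fin => le_s; rewrite ltNge le_s.
Qed.

(** * The law of the process at a fixed time *)

Definition alive n (t : R) : set Omega := [set w | (T n w <= t < T n.+1 w)%R].

Let measurable_alive n t : measurable (alive n t).
Proof.
rewrite (_ : alive n t = T n @^-1` `]-oo, t]%classic `&` T n.+1 @^-1` `]t, +oo[%classic).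
  by apply: measurableI; exact: mT.
apply/seteqP; split => w; rewrite /alive/= !in_itv/= andbT.
  by move=> /andP[].
by move=> [-> ->].
Qed.

Definition transition t v : \bar R := \esum_(n in [set: nat]) occ n v t.

Lemma transition_ge0 t v : 0 <= transition t v.
Proof. exact: esum_ge0. Qed.

Let at_time t (B : set (state N)) : set Omega :=
  [set w | exists2 v, B v & process u X t w = Some v].

(** Off the event [good] several indices may qualify, and the process uses the
first one. *)
Let at_timeE t B : at_time t B = \bigcup_n
  (alive n t `&` Z n @^-1` B `&` \bigcap_(k in `I_n) ~` alive k t).
Proof.
apply/seteqP; split => w.
  move=> [v Bv]; rewrite /process; case: pselect => // ex [Zv].
  case: (ex_minnP ex) Zv => m am min Zv; exists m => //.
  split; first by split => //; rewrite /= /preimage/mkset Zv.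
  by move=> k /= km ak; have := min k ak; rewrite leqNgt km.
move=> [n _ [[an Zn] first_n]]; exists (Z n w) => //.
rewrite /process; case: pselect => [ex|]; last by case; exists n.
case: (ex_minnP ex) => m am min.
have [mn|nm|-> //] := ltngtP m n; first by case: (first_n m mn).
by have := min n an; rewrite leqNgt nm.
Qed.

Let measurable_at_time t B : measurable (at_time t B).
Proof.
rewrite at_timeE; apply: bigcupT_measurable => n.
apply: measurableI; first exact: measurableI.
apply: fin_bigcap_measurable; first exact: finite_II.
by move=> k _; exact: measurableC.
Qed.

Lemma alive_disjoint w m n t : good w -> alive m t w -> alive n t w -> m = n.
Proof.
move=> gw; wlog mn : m n / (m <= n)%N => [sym|].
  have [/sym//|/ltnW/sym nm am an] := leqP m n.
  by rewrite nm.
move=> /andP[_ tm] /andP[tn _]; apply/eqP; rewrite eqn_leq mn/= leqNgt.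
apply/negP => mltn; have := jump_time_homo gw mltn.
by rewrite leNgt (le_lt_trans tn tm).
Qed.

Lemma process_law t (B : set (state N)) :
  P [set w | exists2 v, B v & process u X t w = Some v] =
  \esum_(v in [set: state N]) (if v \in B then transition t v else 0).
Proof.
rewrite -/(at_time t B) -(measure_good)//.
pose F n := Z n @^-1` B `&` alive n t `&` good.
have -> : at_time t B `&` good = \bigcup_n F n.
  rewrite at_timeE; apply/seteqP; split => w.
    by move=> [[n _ [[an Zn] _]] gw]; exists n.
  move=> [n _ [[Zn an] gw]]; split => //; exists n => //; split => //.
  move=> k /= kn ak; have := alive_disjoint gw ak an.
  by move=> kE; rewrite kE ltnn in kn.
have mg := measurable_good.
have mF n : measurable (F n) by do 2 apply: measurableI => //.
rewrite measure_semi_bigcup//; last 2 first.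
- apply/trivIsetP => i j _ _ ij; apply/seteqP; split => // w [[[_ ai] gw] [[_ aj] _]].
  by move: ij; rewrite (alive_disjoint gw ai aj) eqxx.
- exact: bigcupT_measurable.
have PF n : P (F n) = \esum_(v in [set: state N]) (if v \in B then occ n v t else 0).
  rewrite /F (measure_good)//; last exact: measurableI.
  rewrite (measure_esum P (Z := Z n)); last by move=> v; do 2 apply: measurableI => //.
  apply: eq_esum => v _; case: ifPn => [/set_mem Bv|/negP nB].
    rewrite /occ; congr (P _); apply/seteqP; split => w [].
      by move=> [_ aw] Zv; split.
    by move=> Zv aw; split => //; split => //; rewrite /preimage/mkset Zv.
  rewrite (_ : _ `&` _ = set0) ?measure0//; apply/seteqP; split => // w [[Bw _] /= Zv].
  by apply: nB; apply/mem_set; rewrite -Zv.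
rewrite (eq_eseriesr (fun n _ => PF n)) nneseries_esumT; last first.
  by move=> n; apply: esum_ge0 => v _; case: ifP.
rewrite esum_swap; last by move=> n v; case: ifP.
apply: eq_esum => v _; case: ifP => // _.
by rewrite esum1.
Qed.

(** Non-explosion in the form in which it enters the proof of invariance. *)
Lemma mass_transition t : (0 <= t)%R -> mass (transition t) = 1.
Proof.
move=> t0; transitivity (P (at_time t setT)).
  by rewrite process_law; apply: eq_esum => v _; rewrite in_setT.
apply/eqP; rewrite eq_le probability_le1//=.
rewrite -unbounded_jump_times; apply: le_measure; rewrite ?inE//.
  exact: measurable_unbounded.
by move=> w /process_exists_iff/(_ t t0)[v Zv]; exists v.
Qed.

End Process.

(** * Measures on the space of lists *)

Section DiscreteMeasures.
Context (R : realType) (N : nat).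
Implicit Types (B : set (state N)) (v : state N).

Lemma discrete_measureE (mu : {measure set (state N) -> \bar R}) B :
  mu B = \esum_(v in [set: state N]) (if v \in B then mu [set v] else 0).
Proof.
rewrite (measure_esum mu (Z := id))//; apply: eq_esum => v _.
case: ifPn => [/set_mem Bv|/negP nB]; first by rewrite setIidr// => _ ->.
rewrite (_ : _ `&` _ = set0) ?measure0//; apply/seteqP; split => // w [Bw wv].
by apply: nB; apply/mem_set; rewrite -wv.
Qed.

Lemma discrete_integralE (mu : {measure set (state N) -> \bar R})
    (f : state N -> \bar R) : (forall v, 0 <= f v) ->
  \int[mu]_v f v = \esum_(v in [set: state N]) mu [set v] * f v.
Proof.
move=> f0.
rewrite (eq_integral (fun w => \esum_(v in [set: state N]) (f v * (\1_[set v] w)%:E))).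
  rewrite integral_esum//; last by move=> v w; rewrite mule_ge0// lee_fin.
  apply: eq_esum => v _; rewrite ge0_integralZl//.
  by rewrite integral_indic// setIT muleC.
move=> w _; rewrite (esum_pick (u := w)).
- by rewrite indicE mem_set// mule1.
- by move=> v vw; rewrite indicE memNset ?mule0//= => wv; rewrite wv eqxx in vw.
- by rewrite mule_ge0// lee_fin.
Qed.

Section Weights.
Variable m : state N -> \bar R.
Hypotheses (m0 : forall v, 0 <= m v) (m1 : mass m = 1).

Definition weighted B : \bar R :=
  \esum_(v in [set: state N]) (if v \in B then m v else 0).

Let weighted0 : weighted set0 = 0.
Proof. by rewrite /weighted esum1// => v _; rewrite in_set0. Qed.

Let weighted_ge0 B : 0 <= weighted B.
Proof. by apply: esum_ge0 => v _; case: ifP. Qed.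

Let weighted_sigma_additive : semi_sigma_additive weighted.
Proof.
move=> F mF tF mUF.
rewrite (_ : weighted _ = \sum_(n <oo) weighted (F n)).
  by apply: is_cvg_nneseries => n _ _; exact: weighted_ge0.
rewrite nneseries_esumT; last by move=> n; exact: weighted_ge0.
rewrite /weighted esum_swap; last by move=> n v; case: ifP.
apply: eq_esum => v _; case: ifPn => [/set_mem[n _ Fnv]|/negP nF].
  rewrite (esum_pick (u := n)); first by rewrite mem_set.
    move=> k kn; rewrite memNset// => Fkv.
    move/trivIsetP : tF => /(_ k n I I kn) /seteqP[/(_ v) + _].
    by apply.
  by case: ifP.
rewrite esum1// => n _; rewrite memNset// => Fnv.
by apply: nF; apply/mem_set; exists n.
Qed.

HB.instance Definition _ := isMeasure.Build _ _ _ weighted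
  weighted0 weighted_ge0 weighted_sigma_additive.

Let weightedT : weighted setT = 1.
Proof. by rewrite -m1; apply: eq_esum => v _; rewrite in_setT. Qed.

HB.instance Definition _ := @Measure_isProbability.Build _ _ R weighted weightedT.

Lemma exists_weighted_probability :
  exists mu : probability (state N) R, forall v, mu [set v] = m v.
Proof.
exists weighted => v; rewrite /= /weighted (esum_pick (u := v)).
- by rewrite mem_set.
- by move=> w wv; rewrite memNset//= => E; rewrite E eqxx in wv.
- by case: ifP.
Qed.

End Weights.
End DiscreteMeasures.

(** * The forward system and the balance equations *)

Section SurvivalIntegral.
Context (R : realType) (N : nat) (beta : R).
Hypothesis hN : (0 < N)%N.
Local Notation q := (total_rate beta).
Local Notation leb := (@lebesgue_measure R).

Lemma integral_survival (v : state N) t : (0 <= t)%R ->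
  \int[leb]_s (if (0 <= s)%R then (survival beta v t s)%:E else 0) =
  ((1 - expR (- q v * t)) / q v)%:E.
Proof.
move=> t0; have q0 := total_rate_gt0 beta hN v.
pose f (s : R) := expR (- q v * (t - s))%R.
transitivity (\int[leb]_(s in `[0%R, t]) (f s)%:E).
  rewrite [RHS]integral_mkcond; apply: eq_integral => s _.
  rewrite patchE /survival; case: ifPn => s0.
    have [st|st] := boolP (s <= t)%R.
      by rewrite mem_set//= in_itv/= s0 st.
    by rewrite memNset//= in_itv/= s0 (negPf st).
  by rewrite memNset//= in_itv/= (negPf s0).
move: t0; rewrite le_eqVlt => /predU1P[<-|t0].
  rewrite set_itv1 integral_set1 mulr0 expR0 subrr mul0r//.
pose F (s : R) := (f s / q v)%R.
have dF (s : R^o) : is_derive s (1%R : R^o) (F : R^o -> R^o) (f s).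
  rewrite /F /f; apply: is_derive_eq.
  by rewrite /GRing.scale/=; field; rewrite gt_eqF.
have cF : continuous F.
  by move=> s; apply/differentiable_continuous/derivable1_diffP; case: (dF s).
have cf : continuous f.
  rewrite (_ : f = fun s => q v * F s)%R; last first.
    by apply/funext => s; rewrite /F mulrC divfK// gt_eqF.
  by move=> s; apply: continuousM; [exact: cst_continuous|exact: cF].
rewrite (continuous_FTC2 (F := F) t0).
- by rewrite /F /f subrr mulr0 expR0 subr0 -EFinB -mulrBl.
- exact: continuous_subspaceT.
- split.
  + by move=> s _; case: (dF s).
  + by apply: cvg_at_right_filter; exact: cF.
  + by apply: cvg_at_left_filter; exact: cF.
- by move=> s _; rewrite derive1E; case: (dF s).
Qed.

End SurvivalIntegral.

(** The forward equations, averaged over a starting measure [mu] and abstracted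
from the probability space. *)
Section ForwardSystem.
Context (R : realType) (N : nat) (beta : R).
Hypothesis hN : (0 < N)%N.
Local Notation q := (total_rate beta).
Local Notation leb := (@lebesgue_measure R).
Local Notation surv := (survival beta).

Definition balanced (mu : state N -> \bar R) :=
  forall v', \esum_(v in [set: state N]) mu v * (jump_rate beta v v')%:E =
             mu v' * (q v')%:E.

Variables (mu : state N -> \bar R) (a : nat -> R -> state N -> \bar R).
Hypothesis mu0 : forall v, 0 <= mu v.
Hypothesis a_ge0 : forall n t v, 0 <= a n t v.
Hypothesis measurable_a : forall n v, measurable_fun setT (fun t => a n t v).
Hypothesis a_lt0 : forall n t v, (t < 0)%R -> a n t v = 0.
Hypothesis a_start : forall t v, a 0 t v = mu v * (surv v t 0)%:E.
Hypothesis a_step : forall n t v', a n.+1 t v' = \esum_(v in [set: state N])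
  ((jump_rate beta v v')%:E * \int[leb]_s ((surv v' t s)%:E * a n s v)).

Let q0 v : (0 < q v)%R := total_rate_gt0 beta hN v.

Let jump0 (v v' : state N) : 0 <= (jump_rate beta v v')%:E.
Proof. by rewrite lee_fin jump_rate_ge0. Qed.

Let surv0 (v : state N) t s : 0 <= (surv v t s)%:E.
Proof. by rewrite lee_fin survival_ge0. Qed.

Let surv_a0 (v' : state N) t n s v : 0 <= (surv v' t s)%:E * a n s v.
Proof. by apply: mule_ge0; [exact: surv0|exact: a_ge0]. Qed.

Let int0 (v' : state N) t n v : 0 <= \int[leb]_s ((surv v' t s)%:E * a n s v).
Proof. by apply: integral_ge0 => s _; exact: surv_a0. Qed.

Let jump_int0 (v' : state N) t n v :
  0 <= (jump_rate beta v v')%:E * \int[leb]_s ((surv v' t s)%:E * a n s v).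
Proof. by apply: mule_ge0; [exact: jump0|exact: int0]. Qed.

Let mu_jump0 v v' : 0 <= mu v * (jump_rate beta v v')%:E.
Proof. by apply: mule_ge0; [exact: mu0|exact: jump0]. Qed.

Let msurv (v : state N) t : measurable_fun setT (fun s => (surv v t s)%:E).
Proof. by apply/measurable_EFinP; exact: measurable_survivalr. Qed.

Let msurv_a (v' : state N) t n v :
  measurable_fun setT (fun s => (surv v' t s)%:E * a n s v).
Proof. by apply: emeasurable_funM; [exact: msurv|exact: measurable_a]. Qed.

Let leave (v : state N) (t : R) : R := (1 - expR (- q v * t))%R.

Let leave_ge0 (v : state N) t : (0 <= t)%R -> (0 <= leave v t)%R.
Proof. by move=> t0; rewrite subr_ge0 expR_le1 mulNr oppr_le0 mulr_ge0// ltW. Qed.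

(** Flow in at a constant rate from time 0 on. *)
Let integral_constant (v : state N) t (c : \bar R) (f : R -> \bar R) : (0 <= t)%R -> 0 <= c ->
  (forall s, f s = if (0 <= s)%R then c else 0) ->
  \int[leb]_s ((surv v t s)%:E * f s) = c * (leave v t / q v)%:E.
Proof.
move=> t0 c0 fE; rewrite -(integral_survival beta hN v t0) -ge0_integralZl//.
- apply: eq_integral => s _; rewrite fE; case: ifP => _; first by rewrite muleC.
  by rewrite !mule0.
- apply: measurable_fun_ifT => //; last exact: msurv.
  by apply: measurable_fun_ler => //; exact: measurable_cst.
- by move=> s _; case: ifP.
Qed.

Definition occupation t v : \bar R := \esum_(n in [set: nat]) a n t v.

Lemma occupation_forward t v' :
  occupation t v' = mu v' * (surv v' t 0)%:E + \esum_(v in [set: state N])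
    ((jump_rate beta v v')%:E * \int[leb]_s ((surv v' t s)%:E * occupation s v)).
Proof.
rewrite /occupation esum_nat_recl// a_start; congr (_ + _).
under eq_esum => n _ do rewrite a_step.
rewrite esum_swap; last by move=> n v; exact: jump_int0.
apply: eq_esum => v _; rewrite esumZl; [|exact: jump0|by move=> n; exact: int0].
congr (_ * _).
rewrite -integral_esum//.
- by apply: eq_integral => s _; rewrite esumZl//; exact: surv0.
- by move=> n; exact: msurv_a.
Qed.

(** If the measure with fewer jumps never exceeds [mu], then by balance the flow
into [v'] never exceeds [mu v' q v']. At time [t] that flow contributes at most
[mu v' (1 - exp (- q v' t))], which is what the initial mass at [v'] has lost. *)
Lemma partial_occupation_le M t v : balanced mu ->
  \sum_(n < M) a n t v <= mu v.
Proof.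
move=> bal; elim: M t v => [|M IH] t v'; first by rewrite big_ord0.
have [t0|t0] := ltP t 0%R.
  by rewrite big1// => n _; exact: a_lt0.
rewrite big_ord_recl/= a_start.
under eq_bigr => n _ do rewrite /bump/= add1n a_step.
rewrite -esum_sum; last by move=> *; exact: jump_int0.
apply: (@le_trans _ _ (mu v' * (surv v' t 0)%:E + \esum_(v in [set: state N])
    ((mu v * (jump_rate beta v v')%:E) * (leave v' t / q v')%:E))).
  apply: leeD => //; apply: le_esum => v _.
  rewrite -ge0_sume_distrr// -muleA muleCA; apply: lee_wpmul2l => //.
  rewrite -ge0_integral_sum//; last by move=> n; exact: msurv_a.
  rewrite -(@integral_constant v' t (mu v) (fun s => if (0 <= s)%R then mu v else 0))//.
  apply: ge0_le_integral => //.
  - by move=> s _; apply: sume_ge0 => n _; exact: surv_a0.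
  - by apply: emeasurable_sum => n; exact: msurv_a.
  - apply: emeasurable_funM; [exact: msurv|apply: measurable_fun_ifT => //].
    by apply: measurable_fun_ler => //; exact: measurable_cst.
  - move=> s _; rewrite -ge0_sume_distrr//; apply: lee_wpmul2l => //.
    case: ifPn => [_|]; first exact: IH.
    by rewrite -ltNge => s0; rewrite big1// => n _; exact: a_lt0.
have leave0 : 0 <= (leave v' t / q v')%:E.
  by rewrite lee_fin divr_ge0 ?leave_ge0// ltW.
rewrite esumZr//.
rewrite bal -muleA -EFinM mulrC divfK ?gt_eqF// -ge0_muleDr//; last first.
  by rewrite lee_fin leave_ge0.
rewrite /survival t0 subr0 -EFinD /leave addrC subrK mule1//.
Qed.

Lemma occupation_le t v : balanced mu -> occupation t v <= mu v.
Proof.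
move=> bal; rewrite /occupation -nneseries_esumT//.
apply: lime_le; first by apply: is_cvg_nneseries.
by apply: nearW => M; rewrite big_mkord; exact: partial_occupation_le.
Qed.

(** For a stationary measure the flow is constant in time, and the forward equation
at time 1 reads [mu v' = mu v' e + B (1 - e) / q v'] with [e = exp (- q v')] and
[B] the flow into [v']. That [B] is finite comes out of this equation. *)
Lemma stationary_balanced : (forall v, mu v \is a fin_num) ->
  (forall t v, (0 <= t)%R -> occupation t v = mu v) -> balanced mu.
Proof.
move=> mufin stat v'; have := occupation_forward 1%R v'.
rewrite stat//.
under eq_esum => v _.
  rewrite (@integral_constant v' 1%R (mu v))//; last first.
    move=> s; case: ifPn => [s0|]; first exact: stat.
    by rewrite -ltNge => s0; apply: esum1 => n _; exact: a_lt0.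
  rewrite muleA [X in X * _]muleC.
  over.
have e1 : (expR (- q v') < 1)%R by rewrite expR_lt1 oppr_lt0.
have leave0 : 0 <= (leave v' 1 / q v')%:E.
  by rewrite lee_fin divr_ge0 ?leave_ge0// ltW.
have c0 : (0 < leave v' 1 / q v')%R.
  by rewrite divr_gt0// /leave mulr1 subr_gt0.
rewrite esumZr//.
set B := \esum_(v in _) _.
have B0 : 0 <= B by apply: esum_ge0 => v _; exact: mu_jump0.
rewrite /survival ler01 subr0.
rewrite -(fineK (mufin v')); set x := fine _.
case: B B0 => [b b0|_|//].
  rewrite -!EFinM -EFinD => -[xE]; congr (_%:E).
  rewrite /leave mulr1 in xE.
  have : (x * (1 - expR (- q v')) = b * ((1 - expR (- q v')) / q v'))%R.
    by rewrite mulrBr mulr1 [X in (X - _)%R]xE addrC addKr.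
  move=> E2.
  have nz : (1 - expR (- q v') != 0)%R by rewrite gt_eqF// subr_gt0.
  apply: (mulIf nz); rewrite mulrAC E2; field; rewrite gt_eqF//.
by rewrite gt0_mulye ?lte_fin// addey.
Qed.

End ForwardSystem.

(** * Invariance and balance *)

Section Mixture.
Context (R : realType) (N : nat) (beta : R).
Context d (Omega : measurableType d) (P : probability Omega R).
Variable tau : state N -> nat -> mark N -> {RV P >-> R}.
Hypothesis hN : (0 < N)%N.
Hypothesis beta_ge0 : (0 <= beta)%R.
Hypothesis clocks : forall u, exponential_clocks beta u (tau u).
Local Notation q := (total_rate beta).
Local Notation leb := (@lebesgue_measure R).
Local Notation surv := (survival beta).

Section Weights.
Variable nu : state N -> \bar R.
Hypothesis nu0 : forall v, 0 <= nu v.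

Definition mixed n t v : \bar R := \esum_(u in [set: state N]) nu u * occ u (tau u) n v t.

Let occ0' u n v t : 0 <= occ u (tau u) n v t. Proof. exact: measure_ge0. Qed.

Let nu_occ0 u n v t : 0 <= nu u * occ u (tau u) n v t.
Proof. by apply: mule_ge0. Qed.

Lemma mixed_ge0 n t v : 0 <= mixed n t v.
Proof. by apply: esum_ge0 => u _; exact: nu_occ0. Qed.

Let measurable_nu_occ u n v :
  measurable_fun setT (fun t => nu u * occ u (tau u) n v t).
Proof. by apply: emeasurable_funM; [exact: measurable_cst|exact: (measurable_occ hN (@clocks u) n v)]. Qed.

Lemma measurable_mixed n v : measurable_fun setT (fun t => mixed n t v).
Proof. by apply: measurable_esum => [u|u t]; [exact: measurable_nu_occ|exact: nu_occ0]. Qed.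

Lemma mixed_lt0 n t v : (t < 0)%R -> mixed n t v = 0.
Proof.
move=> t0; apply: esum1 => u _.
by rewrite (occ_lt0 hN (@clocks u))// mule0.
Qed.

Lemma mixed_start t v : mixed 0 t v = nu v * (surv v t 0)%:E.
Proof.
rewrite /mixed (esum_pick (u := v)) ?(occ0 hN (@clocks _)) ?eqxx//.
- by move=> u uv; rewrite (occ0 hN (@clocks _)) eq_sym (negPf uv) mule0.
- by rewrite mule_ge0// lee_fin survival_ge0.
Qed.

Lemma mixed_step n t v' : mixed n.+1 t v' = \esum_(v in [set: state N])
  ((jump_rate beta v v')%:E * \int[leb]_s ((surv v' t s)%:E * mixed n s v)).
Proof.
have jump0 v : 0 <= (jump_rate beta v v')%:E by rewrite lee_fin jump_rate_ge0.
have surv0 s : 0 <= (surv v' t s)%:E by rewrite lee_fin survival_ge0.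
have int0 u v : 0 <= \int[leb]_s ((surv v' t s)%:E * occ u (tau u) n v s).
  by apply: integral_ge0 => s _; exact: mule_ge0.
have msurv : measurable_fun setT (fun s => (surv v' t s)%:E).
  by apply/measurable_EFinP; exact: measurable_survivalr.
rewrite /mixed.
under eq_esum => u _.
  rewrite (occS hN (@clocks u)) -esumZl//; last by move=> v; exact: mule_ge0.
  over.
rewrite esum_swap; last by move=> u v; rewrite mule_ge0// mule_ge0.
apply: eq_esum => v _.
under eq_esum => u _ do rewrite muleCA.
rewrite esumZl//; last by move=> u; exact: mule_ge0.
congr (_ * _).
transitivity (\esum_(u in [set: state N])
    \int[leb]_s ((surv v' t s)%:E * (nu u * occ u (tau u) n v s))).
  apply: eq_esum => u _; rewrite -ge0_integralZl//.
  - by apply: eq_integral => s _; rewrite muleCA.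
  - by apply: emeasurable_funM => //; exact: (measurable_occ hN (@clocks u) n v).
  - by move=> s _; exact: mule_ge0.
rewrite -integral_esum//.
- by apply: eq_integral => s _; rewrite esumZl.
- by move=> u; apply: emeasurable_funM => //; exact: measurable_nu_occ.
- by move=> u s; apply: mule_ge0 => //; exact: nu_occ0.
Qed.

Lemma occupation_mixed t v : occupation mixed t v =
  \esum_(u in [set: state N]) nu u * transition u (tau u) t v.
Proof.
rewrite /occupation /mixed esum_swap; last by move=> *; exact: nu_occ0.
by apply: eq_esum => u _; rewrite esumZl.
Qed.

Lemma mass_occupation t : (0 <= t)%R -> mass (occupation mixed t) = mass nu.
Proof.
move=> t0; rewrite /mass.
under eq_esum => v _ do rewrite occupation_mixed.
rewrite esum_swap; last by move=> u v; rewrite mule_ge0// transition_ge0.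
apply: eq_esum => u _; rewrite esumZl//; last by move=> v; exact: transition_ge0.
by rewrite -/(mass _) (mass_transition hN (@clocks u) beta_ge0)// mule1.
Qed.

(** The law at time [t] is at most [nu], and has the same mass. *)
Lemma balanced_stationary t : mass nu < +oo -> balanced beta nu -> (0 <= t)%R ->
  forall v, occupation mixed t v = nu v.
Proof.
move=> nufin bal t0; apply: esum_squeeze => //.
- by move=> v; apply: esum_ge0 => n _; exact: mixed_ge0.
- move=> v; apply: (occupation_le hN nu0) bal => //.
  + exact: mixed_ge0.
  + exact: measurable_mixed.
  + exact: mixed_lt0.
  + exact: mixed_start.
  + exact: mixed_step.
- by rewrite mass_occupation.
Qed.

Lemma stationary_balanced_mixed : (forall v, nu v \is a fin_num) ->
  (forall t v, (0 <= t)%R -> occupation mixed t v = nu v) -> balanced beta nu.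
Proof.
move=> nufin stat; apply: (stationary_balanced hN nu0) stat => //.
- exact: mixed_ge0.
- exact: measurable_mixed.
- exact: mixed_lt0.
- exact: mixed_start.
- exact: mixed_step.
Qed.

End Weights.

Lemma integral_process_law (nu : probability (state N) R) t (B : set (state N)) :
  \int[nu]_u P [set w | exists2 v, B v &
     process u (fun k p => tau u k p) t w = Some v] =
  \esum_(v in [set: state N])
    (if v \in B then occupation (mixed (fun u => nu [set u])) t v else 0).
Proof.
rewrite discrete_integralE//.
have tr0 u v : 0 <= transition u (tau u) t v by exact: transition_ge0.
under eq_esum => u _.
  rewrite (process_law hN (@clocks u)) -esumZl//; last by move=> v; case: ifP.
  over.
rewrite esum_swap; last by move=> u v; apply: mule_ge0 => //; case: ifP.
apply: eq_esum => v _; case: ifP => _; last by apply: esum1 => u _; rewrite mule0.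
by rewrite occupation_mixed.
Qed.

(** The integral in the definition of invariance is the law at time [t] of the
process started from [nu]. *)
Lemma invariant_iff_balanced (nu : probability (state N) R) :
  invariant_probability tau nu <-> balanced beta (fun u => nu [set u]).
Proof.
have nuT : mass (fun u => nu [set u]) = 1.
  rewrite -(probability_setT nu) (discrete_measureE nu setT).
  by apply: eq_esum => v _; rewrite in_setT.
split=> [inv|bal t B t0].
  apply: stationary_balanced_mixed => // [v|t v t0]; first exact: fin_num_measure.
  rewrite -(inv t [set v] t0) integral_process_law (esum_pick (u := v)).
  - by rewrite mem_set.
  - by move=> w wv; rewrite memNset//= => E; rewrite E eqxx in wv.
  - by case: ifP => // _; apply: esum_ge0 => n _; apply: mixed_ge0.
rewrite integral_process_law (discrete_measureE nu B).
apply: eq_esum => v _; case: ifP => // _.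
by apply: balanced_stationary => //; rewrite nuT ltry.
Qed.

End Mixture.

(** * Existence and uniqueness *)

Section Balance.
Context (R : realType) (N : nat) (beta : R).
Hypothesis hN : (0 < N)%N.
Hypothesis beta_ge0 : (0 <= beta)%R.
Local Notation q := (total_rate beta).
Local Notation K := (@embedded R N beta).

Lemma total_rate_ge1 (v : state N) : (1 <= q v)%R.
Proof.
apply: (le_trans _ (total_rate_ge beta v (Ordinal hN, (0 <= v (Ordinal hN))%R))).
rewrite -expR0 ler_expR -mulrA mulr_ge0//=.
by rewrite -intrM ler0z; case: (lerP 0%R (v (Ordinal hN))) => va; rewrite /opinion_val; lia.
Qed.

Let q0 v : (0 < q v)%R := total_rate_gt0 beta hN v.

Let holding (v : state N) : \bar R := ((q v)^-1)%:E.

Let holding_ge0 v : 0 <= holding v.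
Proof. by rewrite lee_fin invr_ge0 ltW. Qed.

Let rate_holding (v : state N) (x : \bar R) : x * (q v)%:E * holding v = x.
Proof. by rewrite -muleA -EFinM divff ?mule1// gt_eqF. Qed.

Let holding_rate (v : state N) (x : \bar R) : x * holding v * (q v)%:E = x.
Proof. by rewrite -muleA -EFinM mulVf ?mule1// gt_eqF. Qed.

Let K0 := @embedded_ge0 R N beta hN.
Let K1 := @mass_embedded R N beta hN.

(** Balance for [nu] is invariance of the jump intensities [nu v q v] under the
embedded chain. *)
Lemma balanced_push (nu : state N -> \bar R) v' :
  push K (fun v => nu v * (q v)%:E) v' =
  \esum_(v in [set: state N]) nu v * (jump_rate beta v v')%:E.
Proof.
apply: eq_esum => v _; rewrite -muleA -EFinM /embedded mulrC divfK//.
by rewrite gt_eqF.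
Qed.

(** The jump intensities of a balanced probability are finite at the ladder, though
their sum might a priori be infinite; the uniqueness part of [doeblin] covers
this case. *)
Lemma balanced_unique : exists m : state N -> \bar R,
  [/\ forall v, 0 <= m v, mass m = 1, balanced beta m &
      forall nu, (forall v, 0 <= nu v) -> mass nu = 1 -> balanced beta nu ->
        forall v, nu v = m v].
Proof.
have [delta d0 hdelta] := embedded_doeblin hN beta_ge0.
have [p [p0 p1 pK uniq]] := doeblin K0 K1 d0 hdelta.
pose Zc := mass (fun v => p v * holding v).
have ph0 v : 0 <= p v * holding v by exact: mule_ge0.
have Z0 : 0 <= Zc by exact: mass_ge0.
have Zfin : Zc \is a fin_num.
  rewrite ge0_fin_numE//; apply: (@le_lt_trans _ _ 1); last exact: ltry.
  rewrite -p1; apply: le_esum => v _; rewrite -[leRHS]mule1.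
  by apply: lee_wpmul2l => //; rewrite lee_fin invf_le1// total_rate_ge1.
have Z_gt0 : (0 < fine Zc)%R.
  rewrite lt_neqAle eq_sym fine_ge0// andbT; apply/eqP => Z_0.
  have ZE : Zc = 0 by rewrite -(fineK Zfin) Z_0.
  have p_0 v : p v = 0.
    have : p v * holding v <= 0.
      by rewrite -ZE; apply: (esum_term v (f := fun v => p v * holding v)).
    move=> le0; rewrite -[LHS](holding_rate v).
    by rewrite (_ : p v * holding v = 0) ?mul0e//; apply/eqP; rewrite eq_le le0 ph0.
  by move/eqP: p1; rewrite /mass esum1// eq_sym onee_eq0.
pose c : \bar R := ((fine Zc)^-1)%:E.
have c0 : 0 <= c by rewrite lee_fin invr_ge0 ltW.
have cZ : c * Zc = 1 by rewrite -(fineK Zfin) -EFinM mulVf// gt_eqF.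
have m0 v : 0 <= c * (p v * holding v) by exact: mule_ge0.
exists (fun v => c * (p v * holding v)); split => //.
- by rewrite /mass esumZl.
- move=> v'; rewrite -balanced_push -muleA holding_rate.
  have -> : (fun v => c * (p v * holding v) * (q v)%:E) = fun v => c * p v.
    by apply/funext => v; rewrite -muleA holding_rate.
  by rewrite push_scale// pK.
move=> nu nu0 nu1 bal v.
have nufin w : nu w \is a fin_num.
  rewrite ge0_fin_numE//; apply: (@le_lt_trans _ _ 1); last exact: ltry.
  by rewrite -nu1; exact: esum_term.
pose rho w := nu w * (q w)%:E.
have rho0 w : 0 <= rho w by rewrite mule_ge0// lee_fin ltW.
have rhoK : push K rho = rho by apply/funext => w; rewrite balanced_push bal.
have rhol : rho (ladder N) < +oo.
  by rewrite -ge0_fin_numE// fin_numM.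
have [rhofin rhoE] := uniq rho rho0 rhoK rhol.
have nuE w : nu w = mass rho * (p w * holding w).
  by rewrite muleA -rhoE rate_holding.
have rZ : mass rho * Zc = 1.
  rewrite -nu1; transitivity (\esum_(w in [set: state N]) (mass rho * (p w * holding w))).
    by rewrite esumZl//; exact: mass_ge0.
  by apply: eq_esum => w _; rewrite [RHS]nuE.
have rho_c : mass rho = c by rewrite -[LHS]mule1 -cZ muleCA rZ mule1.
by rewrite nuE rho_c.
Qed.

End Balance.

Local Close Scope ereal_scope.

Theorem theorem1 (R : realType) (N : nat) (hN : (3 <= N)%N)
    (beta : R) (hbeta : 0 <= beta)
    (d : measure_display) (Omega : measurableType d) (P : probability Omega R)
    (tau : state N -> nat -> mark N -> {RV P >-> R})
    (htau : forall u : state N, exponential_clocks beta u (tau u)) :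
  (forall u : state N,
     P [set w | ereal_sup [set (jump_time (fun k p => tau u k p) m w)%:E
                          | m in [set m : nat | (1 <= m)%N]] = +oo%E] = 1%E
     /\ P [set w | forall t : R, 0 <= t ->
                   exists v, process u (fun k p => tau u k p) t w = Some v]
        = 1%E)
  /\ (exists mu : probability (state N) R,
        invariant_probability tau mu
        /\ forall nu : probability (state N) R,
             invariant_probability tau nu ->
             forall B : set (state N), nu B = mu B).
Proof.
have N0 : (0 < N)%N by exact: leq_trans hN.
split=> [u|].
  have unb := unbounded_jump_times N0 (@htau u) hbeta.
  split; rewrite -[RHS]unb; congr (P _); apply/seteqP; split => w.
  - by move=> /sup_jump_times_iff.
  - by move=> ?; apply/sup_jump_times_iff.
  - by move=> /process_exists_iff.
  - by move=> ?; apply/process_exists_iff.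
have [m [m0 m1 bal uniq]] := balanced_unique N0 hbeta.
have [mu muE] := exists_weighted_probability m0 m1.
have massE (nu : probability (state N) R) : mass (fun v => nu [set v]) = 1%E.
  rewrite -(probability_setT nu) (discrete_measureE nu setT).
  by apply: eq_esum => v _; rewrite in_setT.
exists mu; split.
  by apply/(invariant_iff_balanced N0 hbeta htau); rewrite (funext muE).
move=> nu /(invariant_iff_balanced N0 hbeta htau) nu_bal B.
rewrite (discrete_measureE nu) (discrete_measureE mu); apply: eq_esum => v _.
case: ifP => // _; apply: etrans (esym (muE v)).
exact: (uniq (fun w => nu [set w])).
Qed.
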